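(* Let $\mathbf{K}_{2tr}$ denote the class of infinite doubly transitive linear orders. For every uncountable cardinal $\mu$, $$KC_{\mu^+}(\mathbf{K}_{2tr})\le\omega .$$
   Context: A linear order $(I,\le)$ is in $\mathbf{K}_{2tr}$ if and only if $I$ is a (nonempty, infinite) dense linear order with no endpoints such that for all $a<b$ and $c<d$ from $I$, the closed interval $[a,b]$ is isomorphic (as a linear order) to the closed interval $[c,d]$. For elementarily equivalent structures $M,N$ in the same language and an infinite cardinal $\lambda$, a $\lambda$-partial isomorphism is a partial elementary map from $M$ to $N$ whose domain $D\subseteq M$ has cardinality less than $\lambda$ (i.e. $M\models\varphi(d_1,\dots,d_n)$ iff $N\models\varphi(f(d_1),\dots,f(d_n))$ for all first-order formulas $\varphi$ and all $d_i\in D$). $\mathcal F_\lambda(M,N)$ is the family of these, and $\mathcal F_\lambda(M)=\mathcal F_\lambda(M,M)$. For $f\in\mathcal F_\lambda(M,N)$: $\mathrm{Rank}(f)\ge 0$ always; for $\alpha$ limit, $\mathrm{Rank}(f)\ge\alpha$ iff $\mathrm{Rank}(f)\ge\beta$ for all $\beta<\alpha$; and $\mathrm{Rank}(f)\ge\alpha+1$ iff (a) for every $C\subseteq M$ of size less than $\lambda$ there is $g\in\mathcal F_\lambda(M,N)$ extending $f$ with $C\subseteq\mathrm{dom}(g)$ and $\mathrm{Rank}(g)\ge\alpha$, and (b) for every $C\subseteq N$ of size less than $\lambda$ there is $g\in\mathcal F_\lambda(M,N)$ extending $f$ with $C\subseteq\mathrm{range}(g)$ and $\mathrm{Rank}(g)\ge\alpha$.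 The $\lambda$-Karp complexity $KC_\lambda(M)$ is the least ordinal $\alpha$ such that $\mathrm{Rank}(f)\ge\alpha$ implies $\mathrm{Rank}(f)\ge\alpha+1$ for all $f\in\mathcal F_\lambda(M)$. For a class $\mathbf K$ of structures, $KC_\lambda(\mathbf K)$ is the supremum of the ordinals $KC_\lambda(M)$, $M\in\mathbf K$, if this supremum exists, and $KC_\lambda(\mathbf K)=\infty$ otherwise. *)

(* Defs.v *)
From mathcomp Require Import all_boot all_order all_algebra.
From mathcomp Require Import boolp classical_sets functions cardinality.
From mathcomp Require Import set_interval.
From mathcomp Require wochoice.

Set Implicit Arguments.
Unset Strict Implicit.
Unset Printing Implicit Defensive.

Local Open Scope classical_set_scope.
Local Open Scope card_scope.

(** Cardinals are represented by types: [lam : Type] stands for the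
    cardinality of [lam]. *)

Definition card_lt (T U : Type) (A : set T) (B : set U) : Prop :=
  A #<= B /\ ~ (B #<= A).

Definition is_card_succ (mu lam : Type) : Prop :=
  card_lt [set: mu] [set: lam] /\
  forall X : Type, card_lt [set: mu] [set: X] -> [set: lam] #<= [set: X].

(** Ordinals are well-ordered types, considered up to isomorphism [oeq].
    [wochoice.well_order] is about reflexive relations, and implies that they
    are total orders. *)

Record Ord : Type := MkOrd {
  osort : Type;
  oleq : rel osort;
  oleq_wo : wochoice.well_order oleq }.

Definition oeq (a b : Ord) : Prop :=
  exists2 f : osort a -> osort b,
    bijective f & forall x y, oleq (f x) (f y) = oleq x y.

(* [a] is isomorphic to an initial segment of [b] *)
Definition ole (a b : Ord) : Prop :=
  exists f : osort a -> osort b,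
    (forall x y, oleq (f x) (f y) = oleq x y) /\
    (forall x z, oleq z (f x) -> exists y, f y = z).

Definition olt (a b : Ord) : Prop := ole a b /\ ~ oeq a b.

Lemma ozero_wo : wochoice.well_order (fun _ _ : void => true).
Proof. by move=> A [[]]. Qed.

Definition ozero : Ord := MkOrd ozero_wo.

Lemma omega_wo : wochoice.well_order leq.
Proof.
apply: wochoice.antisymmetric_well_order; first exact: anti_leq.
move=> A Ane; exists (ex_minn Ane); case: ex_minnP => m Am mmin.
by split=> // n /mmin.
Qed.

Definition omega : Ord := MkOrd omega_wo.

(* the order of [a] with a new greatest element [None] *)
Definition osucc_leq (a : Ord) (x y : option (osort a)) : bool :=
  match x, y with
  | _, None => true
  | None, Some _ => false
  | Some x, Some y => oleq x y
  end.

Lemma osucc_wo (a : Ord) : wochoice.well_order (@osucc_leq a).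
Proof.
move=> A Ane.
have [[x Ax]|noA] := pselect (exists x, Some x \in A).
  have [z [[Az zmin] zuniq]] := @oleq_wo a [pred x | Some x \in A]
    (ex_intro _ x Ax).
  exists (Some z); split=> [|[t|] [At tmin]]; last 1 first.
  - by have := tmin _ Az.
  - by split=> // -[y|//] Ay; apply: zmin.
  - by congr Some; apply: zuniq; split=> // y Ay; apply: (tmin (Some y)).
have AN y : y \in A -> y = None.
  by case: y => // y Ay; case: noA; exists y.
case: Ane => y Ay; have yN := AN _ Ay; subst y.
exists None; split=> [|t [/AN -> //]].
by split=> // y /AN ->.
Qed.

Definition osucc (a : Ord) : Ord := MkOrd (@osucc_wo a).

Definition olimit (a : Ord) : Prop :=
  ~ oeq a ozero /\ ~ (exists b, oeq a (osucc b)).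

(** [formula L n] is the type of formulas whose free variables are among [n]
    given ones; in [FAll phi], the bound variable is number [ord0] of [phi],
    and variable [j] of the context becomes number [lift ord0 j]. *)

Record language : Type := Language {
  lfun : Type;
  lrel : Type;
  lfun_ar : lfun -> nat;
  lrel_ar : lrel -> nat }.

Record structure (L : language) : Type := Structure {
  carrier :> Type;
  interp_fun : forall F : lfun L, ('I_(lfun_ar F) -> carrier) -> carrier;
  interp_rel : forall R : lrel L, ('I_(lrel_ar R) -> carrier) -> Prop }.

Inductive term (L : language) (n : nat) : Type :=
| TVar of 'I_n
| TApp (F : lfun L) of ('I_(lfun_ar F) -> term L n).

Inductive formula (L : language) : nat -> Type :=
| FFalse n : formula L n
| FEq n of term L n & term L n : formula L n
| FRel n (R : lrel L) of ('I_(lrel_ar R) -> term L n) : formula L n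
| FImp n of formula L n & formula L n : formula L n
| FAll n of formula L n.+1 : formula L n.

Fixpoint eval (L : language) (M : structure L) (n : nat) (v : 'I_n -> M)
    (t : term L n) : M :=
  match t with
  | TVar i => v i
  | TApp F ts => interp_fun (fun i => eval v (ts i))
  end.

Definition vcons (T : Type) (n : nat) (x : T) (v : 'I_n -> T) : 'I_n.+1 -> T :=
  fun i => if unlift ord0 i is Some j then v j else x.

Fixpoint sat (L : language) (M : structure L) (n : nat) (phi : formula L n) :
    ('I_n -> M) -> Prop :=
  match phi in formula _ n return ('I_n -> M) -> Prop with
  | FFalse _ => fun _ => False
  | FEq _ s t => fun v => eval v s = eval v t
  | FRel _ R ts => fun v => interp_rel (fun i => eval v (ts i))
  | FImp _ phi psi => fun v => sat phi v -> sat psi v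
  | FAll _ phi => fun v => forall x : M, sat phi (vcons x v)
  end.

(** Partial maps from [T] to [U] are functions [T -> option U]. *)

Definition pdom (T U : Type) (f : T -> option U) : set T :=
  [set x | exists y, f x = Some y].

Definition prange (T U : Type) (f : T -> option U) : set U :=
  [set y | exists x, f x = Some y].

Definition pextends (T U : Type) (g f : T -> option U) : Prop :=
  forall x y, f x = Some y -> g x = Some y.

(* The case [n = 0] says that [M] and [N] are elementarily equivalent. *)
Definition elementary_pmap (L : language) (M N : structure L)
    (f : M -> option N) : Prop :=
  forall (n : nat) (phi : formula L n) (v : 'I_n -> M) (w : 'I_n -> N),
    (forall i, f (v i) = Some (w i)) -> (sat phi v <-> sat phi w).

Definition partial_iso (lam : Type) (L : language) (M N : structure L)
    (f : M -> option N) : Prop :=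
  card_lt (pdom f) [set: lam] /\ elementary_pmap f.

(* [Rank_ge lam a f] means Rank(f) >= a.  Each ordinal is exactly one of zero,
   a limit and a successor, so exactly one constructor applies and the
   implications in the constructors are equivalences. *)
Inductive Rank_ge (lam : Type) (L : language) (M N : structure L) :
    Ord -> (M -> option N) -> Prop :=
| Rank_ge_zero a f : oeq a ozero -> Rank_ge lam a f
| Rank_ge_limit a f : olimit a ->
    (forall b, olt b a -> Rank_ge lam b f) ->
    Rank_ge lam a f
| Rank_ge_succ a b f : oeq a (osucc b) ->
    (forall C : set M, card_lt C [set: lam] ->
      exists g : M -> option N,
        [/\ partial_iso lam g, pextends g f, C `<=` pdom g &
            Rank_ge lam b g]) ->
    (forall C : set N, card_lt C [set: lam] ->
      exists g : M -> option N,
        [/\ partial_iso lam g, pextends g f, C `<=` prange g &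
            Rank_ge lam b g]) ->
    Rank_ge lam a f.

Definition Rank_stable (lam : Type) (L : language) (M : structure L)
    (a : Ord) : Prop :=
  forall f : M -> option M, partial_iso lam f ->
    Rank_ge lam a f -> Rank_ge lam (osucc a) f.

(* [a] is the lam-Karp complexity of [M] *)
Definition is_KC (lam : Type) (L : language) (M : structure L)
    (a : Ord) : Prop :=
  Rank_stable lam M a /\ forall b, Rank_stable lam M b -> ole a b.

(* [s] is the supremum of the lam-Karp complexities of the members of [K]; the
   complexity of the class is infinity if there is no such [s]. *)
Definition is_KC_class (lam : Type) (L : language) (K : structure L -> Prop)
    (s : Ord) : Prop :=
  (forall M, K M -> exists2 a, is_KC lam M a & ole a s) /\
  (forall t, (forall M a, K M -> is_KC lam M a -> ole a t) -> ole s t).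

Definition order_language : language :=
  Language (fun F : void => 0) (fun _ : unit => 2).

Definition order_structure (d : Order.disp_t) (I : orderType d) :
    structure order_language :=
  @Structure order_language I
    (fun F : void => match F with end)
    (fun (_ : unit) (v : 'I_2 -> I) => (v ord0 <= v ord_max)%O).

Definition doubly_transitive (d : Order.disp_t) (I : orderType d) : Prop :=
  [/\ infinite_set [set: I],
      forall x y : I, (x < y)%O -> exists z, (x < z < y)%O,
      forall x : I, exists y, (y < x)%O,
      forall x : I, exists y, (x < y)%O &
      forall a b c e : I, (a < b)%O -> (c < e)%O ->
        exists2 h : I -> I, set_bij `[a, b] `[c, e] h &
          forall x y, `[a, b] x -> `[a, b] y -> (h x <= h y)%O = (x <= y)%O].

Definition K2tr (S : structure order_language) : Prop :=
  exists (d : Order.disp_t) (I : orderType d),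
    doubly_transitive I /\ S = order_structure I.

(* Main.v *)
Require Import Defs.
From mathcomp Require Import all_boot all_order all_algebra.
From mathcomp Require Import boolp classical_sets functions cardinality.
From mathcomp Require Import set_interval.
From mathcomp Require wochoice.

(** Why the theorem holds. In a doubly transitive order, a point can be moved
    inside an interval by an automorphism that fixes everything outside it. So
    finite order-preserving maps extend to automorphisms, and a partial map is
    elementary iff it preserves the order ([elementary_ordpres]). Moreover the
    rank game on a partial map [G] decomposes: each cut of [G] determines a
    convex region on either side, and [G] has rank at least [n] as soon as the
    empty map has rank at least [n] between the two regions of each cut
    ([game_cuts], with [game_between] in the other direction).

    What has to be shown is that if [G] has rank at least [n] for all finite
    [n], and [D] is a set of at most [mu] points, then some single extension of
    [G] to [D] still has all finite ranks ([omega_forth]); the least ordinal at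
    which ranks become stable is then at most [omega]. For each [n] there is a
    reply [g n] of rank at least [n], defined on [C], the union of [D] and of
    the domain of [G]; but these replies differ. A cut of [C] is called good if
    the replies agree about it from one side: either their values below it are
    cofinal in each other, or their values above it are coinitial in each
    other. At a cut where they agree from both sides, the regions are the same
    for all [n], so they are equivalent for games of all finite lengths. Unions
    and intersections of good cuts are good ([good_cut_union]), and [C] splits
    into blocks, the classes of points not separated by any good cut.

    Inside a block, the final map ignores the replies and is patched from
    automorphisms. At an end of the block where the replies agree, the block
    has countable cofinality, by the argument that shows that countably many
    closed unbounded sets meet: otherwise one could climb past all the replies
    countably many times, and the supremum of the climb would be a good cut
    inside the block ([block_cofinal]). So countably many automorphisms suffice
    to reach that end, along a sequence of points on which the map coincides
    with [g 0] ([half_settled]). At an end where the replies disagree, one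
    reply leaves room, between its values on the block and what follows, for a
    value of another reply; in this room a new pair of points can be chosen
    above which the games of all finite lengths are still won, and it becomes
    the end of the block ([half_unsettled]). A cut of the resulting map either
    lies inside a block, where the map agrees with an automorphism, or comes
    from a good cut of [C], where the map behaves like all the replies
    ([assembled_cuts]). *)

Set Implicit Arguments.
Unset Strict Implicit.
Unset Printing Implicit Defensive.

Local Open Scope classical_set_scope.
Local Open Scope card_scope.

(** * Cardinal arithmetic *)

(** Injections as relations: unlike functions, these need no default value
    outside [A], and are readily obtained from maximal sets of pairs. *)
Lemma card_leR T U (A : set T) (B : set U) :
  A #<= B <-> exists R : T -> U -> Prop,
    (forall x, A x -> exists2 y, B y & R x y) /\
    (forall x x' y, A x -> A x' -> R x y -> R x' y -> x = x').
Proof.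
split=> [/card_leP[f]|[R [Rtot Rinj]]].
  exists (fun x y => exists a : A, set_val a = x /\ set_val (f a) = y).
  split=> [x Ax|x x' y Ax Ax' [a [<- <-]] [a' [<- /val_inj eqf]]].
    exists (set_val (f (SigSub (mem_set Ax)))); last by exists (SigSub (mem_set Ax)).
    exact: set_valP.
  by congr set_val; apply/esym; apply: (@inj _ _ _ f) => //; rewrite in_setT.
have /choice[f fP] (a : A) : exists b : B, R (set_val a) (set_val b).
  have [y By Ry] := Rtot _ (set_valP a).
  by exists (SigSub (mem_set By)).
apply/card_leP/injfunPex; exists f => // a a' _ _ eqf; apply: val_inj.
apply: (Rinj _ _ (set_val (f a))); try exact: set_valP; first exact: fP.
by rewrite eqf; apply: fP.
Qed.

(** By Zorn's lemma there is a maximal partial bijection between [A] and [B];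
    it exhausts one of the two. *)
Lemma card_le_total T U (A : set T) (B : set U) : A #<= B \/ B #<= A.
Proof.
pose P (G : set (T * U)) := [/\ G `<=` A `*` B,
  forall x y y', G (x, y) -> G (x, y') -> y = y' &
  forall x x' y, G (x, y) -> G (x', y) -> x = x'].
have [|G [[GAB Gf Gi] Gmax]] := @Zorn_bigcup _ P.
  move=> F FP Ftot; split=> [u [G FG Gu]|x y y' [G FG Gu] [G' FG' Gu']|
    x x' y [G FG Gu] [G' FG' Gu']].
  - by have [+ _ _] := FP _ FG; apply.
  - have [_ f _] := FP _ FG; have [_ f' _] := FP _ FG'.
    have [s|s] := Ftot _ _ FG FG'; first by apply: (f' x) => //; apply: s.
    by apply: (f x) => //; apply: s.
  - have [_ _ f] := FP _ FG; have [_ _ f'] := FP _ FG'.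
    have [s|s] := Ftot _ _ FG FG'; first by apply: (f' _ _ y) => //; apply: s.
    by apply: (f _ _ y) => //; apply: s.
have [Adom|/existsNP[a /not_implyP[Aa /forallNP na]]] :=
  pselect (forall x, A x -> exists y, G (x, y)).
  left; apply/card_leR; exists (fun x y => G (x, y)); split=> [x /Adom[y Gy]|].
    by exists y => //; have [] := GAB _ Gy.
  by move=> x x' y _ _; apply: Gi.
have [Bran|/existsNP[b /not_implyP[Bb /forallNP nb]]] :=
  pselect (forall y, B y -> exists x, G (x, y)).
  right; apply/card_leR; exists (fun y x => G (x, y)); split=> [y /Bran[x Gy]|].
    by exists x => //; have [] := GAB _ Gy.
  by move=> x x' y _ _; apply: Gf.
exfalso; apply: (Gmax (G `|` [set (a, b)])).
  split=> [|s]; first exact: subsetUl.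
  by apply: (na b); apply: s; right.
split=> [u [/GAB//|->//]|x y y' [g|[xa yb]] [g'|[xa' yb']]|
  x x' y [g|[xa yb]] [g'|[xa' yb']]]; subst => //.
- exact: Gf g g'.
- by have := na _ g.
- by have := na _ g'.
- exact: Gi g g'.
- by have := nb _ g.
- by have := nb _ g'.
Qed.

(** Zorn's lemma provides a maximal bijection between [D * bool] and some
    [D] included in [X]; the complement of [D] is finite, since a copy of
    [nat] could be added to [D], and [D] absorbs it. *)
Lemma card_double (X : Type) : infinite_set [set: X] ->
  [set: X * bool] #<= [set: X].
Proof.
move=> Xinf.
pose D (G : set (X * bool * X)) := [set x | exists b y, G ((x, b), y)].
pose P (G : set (X * bool * X)) := [/\
  forall u y y', G (u, y) -> G (u, y') -> y = y',
  forall u u' y, G (u, y) -> G (u', y) -> u = u',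
  forall x b, D G x -> exists y, G ((x, b), y) &
  forall u y, G (u, y) -> D G y].
have [|G [[Gf Gi Gd Gr] Gmax]] := @Zorn_bigcup _ P.
  move=> F FP Ftot; split.
  - move=> u y y' [G FG Gu] [G' FG' Gu'].
    have [f _ _ _] := FP _ FG; have [f' _ _ _] := FP _ FG'.
    have [s|s] := Ftot _ _ FG FG'; first by apply: (f' u) => //; apply: s.
    by apply: (f u) => //; apply: s.
  - move=> u u' y [G FG Gu] [G' FG' Gu'].
    have [_ f _ _] := FP _ FG; have [_ f' _ _] := FP _ FG'.
    have [s|s] := Ftot _ _ FG FG'; first by apply: (f' _ _ y) => //; apply: s.
    by apply: (f _ _ y) => //; apply: s.
  - move=> x b [b' [y [G FG Gy]]]; have [_ _ /(_ x b) d _] := FP _ FG.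
    by have [|z Gz] := d; [exists b', y | exists z, G].
  - move=> u y [G FG /[dup] Gy]; have [_ _ _ /[apply]] := FP _ FG.
    by move=> [b [z Gz]]; exists b, z, G.
have Dfin : finite_set (~` D G).
  apply: contrapT => /infiniteP/card_leR[R [Rtot Rinj]].
  have /choice[e eP] k : exists y, (~` D G) y /\ R k y.
    by have [//|y] := Rtot k; exists y.
  have einj i j : e i = e j -> i = j.
    by move=> eq; apply: (Rinj _ _ (e i)) => //; [|rewrite eq]; apply: (eP _).2.
  have eN k : ~ D G (e k) by apply: (eP k).1.
  pose N := [set u | exists k (b : bool), u = ((e k, b), e (k.*2 + b))].
  apply: (Gmax (G `|` N)).
    split=> [|s]; first exact: subsetUl.
    by apply: (eN 0); exists true, (e 1); apply: s; right; exists 0, true.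
  have DU x : D G x -> D (G `|` N) x by move=> [b [y Gy]]; exists b, y; left.
  have De k : D (G `|` N) (e k).
    by exists true, (e (k.*2 + true)); right; exists k, true.
  split.
  - move=> u y y' [g|[k [b [-> ->]]]] [g'|[k' [b' []]]].
    + exact: Gf g g'.
    + by move=> uE; exfalso; apply: (eN k'); exists b', y; rewrite -uE.
    + by exfalso; apply: (eN k); exists b, y'.
    + by move=> [/einj -> ->] ->.
  - move=> u u' y [g|[k [b [-> ->]]]] [g'|[k' [b' []]]].
    + exact: Gi g g'.
    + by move=> _ yE; subst y; have := eN _ (Gr _ _ g).
    + by have := eN _ (Gr _ _ g').
    + move=> -> /einj kk.
      have bb : b = b'.
        by move: kk => /(congr1 odd); rewrite !oddD !odd_double; case: b b' => -[].
      by subst b'; move/addIn/double_inj: kk => ->.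
  - move=> x b [b' [y [Gy|[k [b'' [-> _ _]]]]]].
      by have [|z Gz] := Gd x b; [exists b', y | exists z; left].
    by exists (e (k.*2 + b)); right; exists k, b.
  - move=> u y [/Gr/DU//|[k [b [_ ->]]]]; exact: De.
have Dinf : infinite_set (D G).
  by move=> fD; apply: Xinf; rewrite -(setUv (D G)) finite_setU.
have /infiniteP/card_leR[R [Rtot Rinj]] := Dinf.
have /choice[e eP] k : exists y, D G y /\ R k y.
  by have [//|y] := Rtot k; exists y.
have einj i j : e i = e j -> i = j.
  by move=> eq; apply: (Rinj _ _ (e i)) => //; [|rewrite eq]; apply: (eP _).2.
have /card_leR[C [Ctot Cinj]] := finite_set_countable Dfin.
apply/card_leR; exists (fun u y =>
  (D G u.1 /\ exists2 y', G (u, y') & G ((y', true), y)) \/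
  (~ D G u.1 /\ exists2 k, C u.1 k & G ((e (k.*2 + u.2), false), y))).
split.
- move=> [x b] _; have [Dx|nDx] := pselect (D G x).
    have [y' Gy'] := Gd _ b Dx; have [y Gy] := Gd _ true (Gr _ _ Gy').
    by exists y => //; left; split=> //; exists y'.
  have [k _ Ck] := Ctot _ nDx; have [y Gy] := Gd _ false (eP (k.*2 + b)).1.
  by exists y => //; right; split=> //; exists k.
- move=> [x b] [x' b'] y _ _ /= [[Dx [z Gz Gy]]|[Dx [k Ck Gy]]]
    [[Dx' [z' Gz' Gy']]|[Dx' [k' Ck' Gy']]].
  + by have [zz] := Gi _ _ _ Gy Gy'; subst z'; apply: Gi Gz Gz'.
  + by have := Gi _ _ _ Gy Gy'.
  + by have := Gi _ _ _ Gy Gy'.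
  + have [/einj kk] := Gi _ _ _ Gy Gy'.
    have bb : b = b'.
      by move: kk => /(congr1 odd); rewrite !oddD !odd_double; case: (b) (b') => -[].
    subst b'; move/addIn/double_inj: kk => kk; subst k'.
    by rewrite (Cinj _ _ _ Dx Dx' Ck Ck').
Qed.

Lemma card_setU_le T (A B : set T) (X : Type) : infinite_set [set: X] ->
  A #<= [set: X] -> B #<= [set: X] -> A `|` B #<= [set: X].
Proof.
move=> Xinf /card_leR[R [Rt Ri]] /card_leR[S [St Si]].
apply: (card_le_trans _ (card_double Xinf)); apply/card_leR.
exists (fun x u => if u.2 then A x /\ R x u.1 else B x /\ S x u.1); split.
  move=> x [Ax|Bx].
    by have [y _ Ry] := Rt _ Ax; exists (y, true).
  by have [y _ Ry] := St _ Bx; exists (y, false).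
move=> x x' [y []] _ _ /= [Ax Ry] [Ax' Ry']; first exact: Ri Ry Ry'.
exact: Si Ry Ry'.
Qed.

Section Small.
Variables mu lam : Type.
Hypothesis mu_uncountable : ~ countable [set: mu].
Hypothesis lam_succ : is_card_succ mu lam.

(** A set strictly smaller than [lam] that does not inject into [mu] would be
    strictly larger than [mu], against the minimality of [lam]. *)
Lemma small_leP T (A : set T) : card_lt A [set: lam] <-> A #<= [set: mu].
Proof.
have [[mulam lammu] lam_min] := lam_succ; split=> [[Alam lamA]|Amu].
  have [//|muA] := card_le_total A [set: mu].
  apply: contrapT => nAmu; apply: lamA.
  suff : [set: lam] #<= [set: A].
    by move/card_le_trans; apply; rewrite (card_le_eql (card_setT A)).
  apply: lam_min; split; first by rewrite (card_le_eqr (card_setT A)).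
  by rewrite (card_le_eql (card_setT A)).
split; first exact: card_le_trans mulam.
by move=> /card_le_trans/(_ Amu).
Qed.

Lemma infinite_mu : infinite_set [set: mu].
Proof. by move/finite_set_countable. Qed.

End Small.

(** * Homogeneous orders and their automorphisms *)

(** The notions below are stated for a bare relation [lt] rather than for an
    ordered type, so that a lemma about lower ends, applied to [dual_lt lt],
    yields its mirror image about upper ends. *)
Definition dual_lt (T : Type) (lt : T -> T -> Prop) : T -> T -> Prop :=
  fun x y => lt y x.

Definition aut (T : Type) (lt : T -> T -> Prop) (s : T -> T) : Prop :=
  (forall x y, lt (s x) (s y) <-> lt x y) /\ (forall y, exists x, s x = y).

Record strict_order (T : Type) (lt : T -> T -> Prop) : Prop := StrictOrder {
  lt_irr : forall x, ~ lt x x;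
  lt_tr : forall y x z, lt x y -> lt y z -> lt x z;
  lt_tot : forall x y, [\/ lt x y, x = y | lt y x] }.

(** Double transitivity enters through [lt_bump]: the isomorphisms between
    closed intervals are extended to automorphisms of the whole order. *)
Record homogeneous (T : Type) (lt : T -> T -> Prop) : Prop := Homogeneous {
  homogeneous_order :> strict_order lt;
  lt_dense : forall x y, lt x y -> exists2 z, lt x z & lt z y;
  lt_unbounded_l : forall x, exists y, lt y x;
  lt_unbounded_r : forall x, exists y, lt x y;
  lt_bump : forall l a b r, lt l a -> lt l b -> lt a r -> lt b r ->
    exists s, [/\ aut lt s, s a = b & forall x, ~ (lt l x /\ lt x r) -> s x = x] }.

#[local] Hint Extern 0 (strict_order _) =>
  (apply: homogeneous_order; eassumption) : core.

Lemma homogeneous_dual T (lt : T -> T -> Prop) :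
  homogeneous lt -> homogeneous (dual_lt lt).
Proof.
move=> h; split; rewrite /dual_lt; first split.
- exact: lt_irr h.
- by move=> y x z xy yz; apply: (lt_tr h) yz xy.
- by move=> x y; case: (lt_tot h x y); [constructor 3|constructor 2|constructor 1].
- by move=> x y /(lt_dense h)[z]; exists z.
- exact: lt_unbounded_r h.
- exact: lt_unbounded_l h.
- move=> l a b r al bl ra rb.
  have [s [[smono ssurj] sa sid]] := lt_bump h ra rb al bl.
  exists s; split=> [|//|x nx]; first by split=> // x y; apply: smono.
  by apply: sid => -[? ?]; apply: nx.
Qed.

Section OrderFacts.
Variables (T : Type) (lt : T -> T -> Prop) (h : strict_order lt).

Lemma le_lt_tr y x z : ~ lt y x -> lt y z -> lt x z.
Proof.
move=> yx yz; case: (lt_tot h x y) => [xy|->//|//]; exact: lt_tr xy yz.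
Qed.

Lemma lt_le_tr y x z : lt x y -> ~ lt z y -> lt x z.
Proof.
move=> xy zy; case: (lt_tot h y z) => [yz|<-//|//]; exact: lt_tr xy yz.
Qed.

Lemma lt_le x y : lt x y -> ~ lt y x.
Proof. by move=> xy yx; apply: (lt_irr h) (lt_tr h xy yx). Qed.

Lemma neq_lt x y : x <> y -> lt x y \/ lt y x.
Proof. by case: (lt_tot h x y); [left| |right]. Qed.
End OrderFacts.

(** Proves goals about [lt] by refuting their negation: the hypotheses are
    saturated under transitivity until a strict cycle appears. *)
Ltac ord h :=
  apply: contrapT => ?;
  match type of h with _ ?lt =>
  repeat match goal with
  | H : ~ ~ lt _ _ |- _ => apply contrapT in H
  | H : ~ False |- _ => clear H
  | H : ~ (?x = ?y) |- _ => apply (neq_lt h) in H; destruct H as [H|H]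
  end;
  repeat match goal with
  | H : lt ?x ?x |- _ => exact (False_ind _ (lt_irr h H))
  | H : lt ?x ?y, K : ~ lt ?x ?y |- _ => exact (False_ind _ (K H))
  | H1 : lt ?x ?y, H2 : lt ?y ?z |- _ =>
    lazymatch goal with _ : lt x z |- _ => fail | _ => idtac end;
    pose proof (lt_tr h H1 H2)
  | H1 : ~ lt ?y ?x, H2 : lt ?y ?z |- _ =>
    lazymatch goal with _ : lt x z |- _ => fail | _ => idtac end;
    pose proof (le_lt_tr h H1 H2)
  | H1 : lt ?x ?y, H2 : ~ lt ?z ?y |- _ =>
    lazymatch goal with _ : lt x z |- _ => fail | _ => idtac end;
    pose proof (lt_le_tr h H1 H2)
  end end.

(** Partial maps are sets of pairs, so that the two sides play symmetric
    roles. As [lt] is total, [ordpres] entails injectivity both ways. *)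
Definition ordpres (T : Type) (lt : T -> T -> Prop) (G : set (T * T)) :=
  forall u v, G u -> G v -> (lt u.1 v.1 <-> lt u.2 v.2).

Definition converse (T : Type) (G : set (T * T)) : set (T * T) :=
  [set u | G (u.2, u.1)].

Definition between (T : Type) (lt : T -> T -> Prop) (A B : set T) : set T :=
  [set x | (forall a, A a -> lt a x) /\ (forall b, B b -> lt x b)].

Section Order.
Variables (T : Type) (lt : T -> T -> Prop).
Hypothesis lt_hom : homogeneous lt.

Lemma aut_inj s x y : aut lt s -> s x = s y -> x = y.
Proof.
move=> [mono _] eq; case: (lt_tot lt_hom x y) => [/mono|//|/mono];
  by rewrite eq => /(lt_irr lt_hom).
Qed.

Lemma aut_id : aut lt id.
Proof. by split=> // y; exists y. Qed.

Lemma aut_comp s t : aut lt s -> aut lt t -> aut lt (s \o t).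
Proof.
move=> [smono ssurj] [tmono tsurj]; split=> [x y /=|y]; first by rewrite smono.
by have [x <-] := ssurj y; have [z <-] := tsurj x; exists z.
Qed.

Lemma aut_glue s t c : aut lt s -> aut lt t -> s c = t c ->
  exists g, [/\ aut lt g, forall x, ~ lt c x -> g x = s x &
    forall x, ~ lt x c -> g x = t x].
Proof.
move=> [smono ssurj] [tmono tsurj] stc.
pose g x := if pselect (lt x c) then s x else t x.
have gs x : ~ lt c x -> g x = s x.
  move=> cx; rewrite /g; case: pselect => //= xc; move: cx xc => cx xc.
  by have {cx xc} -> : x = c; [ord lt_hom|rewrite stc].
have gt x : ~ lt x c -> g x = t x by rewrite /g; case: pselect.
have gmono x y : lt x y -> lt (g x) (g y).
  move=> xy; have [yc|cy] := pselect (lt c y); last first.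
    rewrite !gs //; first exact/smono; ord lt_hom.
  have [xc|cx] := pselect (lt x c); last first.
    rewrite !gt //; first exact/tmono; ord lt_hom.
  rewrite gs ?gt; [|ord lt_hom|ord lt_hom].
  by apply: (@lt_tr _ _ lt_hom (s c)); [apply/smono|rewrite stc; apply/tmono].
exists g; split=> //; split=> [x y|y].
  split; last exact: gmono.
  move=> gxy; case: (lt_tot lt_hom x y) => // [xy|/gmono gyx].
    by rewrite xy in gxy; have := lt_irr lt_hom gxy.
  by have := lt_irr lt_hom (lt_tr lt_hom gxy gyx).
have [[x sx] [z tz]] := (ssurj y, tsurj y).
have [yc|cy] := pselect (lt y (s c)).
  exists x; rewrite gs // => cx.
  by have := (smono c x).2 cx; rewrite sx => ?; ord lt_hom.
exists z; rewrite gt // => cz; apply: cy; rewrite stc -tz; exact/tmono.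
Qed.

Lemma aut_above l a b : lt l a -> lt l b ->
  exists s, [/\ aut lt s, s a = b & forall x, ~ lt l x -> s x = x].
Proof.
move=> la lb; have [r ar br] : exists2 r, lt a r & lt b r.
  have [r ar] := lt_unbounded_r lt_hom a; have [r' br] := lt_unbounded_r lt_hom b.
  have [rr|rr] := pselect (lt r r'); first by exists r' => //; ord lt_hom.
  by exists r => //; ord lt_hom.
have [s [saut sa sid]] := lt_bump lt_hom la lb ar br.
by exists s; split=> // x lx; apply: sid => -[].
Qed.

Lemma lt_lower_bound a b : exists2 l, lt l a & lt l b.
Proof.
have [l la] := lt_unbounded_l lt_hom a; have [l' lb] := lt_unbounded_l lt_hom b.
have [ll|ll] := pselect (lt l l'); first by exists l => //; ord lt_hom.
by exists l' => //; ord lt_hom.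
Qed.

Lemma aut_transitive a b : exists2 s, aut lt s & s a = b.
Proof.
have [l la lb] := lt_lower_bound a b.
by have [s [saut sa _]] := aut_above la lb; exists s.
Qed.

Lemma aut_extend s p p' q q' : aut lt s -> s p = p' -> lt p q -> lt p' q' ->
  exists s', [/\ aut lt s', s' q = q' & forall x, ~ lt p x -> s' x = s x].
Proof.
move=> saut sp pq pq'.
have spq : lt p' (s q) by rewrite -sp; apply/(saut.1).
have [t [taut tq tid]] := aut_above spq pq'.
exists (t \o s); split=> [||x px /=]; [exact: aut_comp|by []|].
by apply: tid; rewrite -sp (saut.1).
Qed.

Lemma aut_two p q p' q' : lt p q -> lt p' q' ->
  exists s, [/\ aut lt s, s p = p' & s q = q'].
Proof.
move=> pq pq'; have [s saut sp] := aut_transitive p p'.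
have [t [taut tq ts]] := aut_extend saut sp pq pq'.
by exists t; split=> //; rewrite ts //; apply: lt_irr.
Qed.

Lemma aut_between s A B : aut lt s ->
  between lt (s @` A) (s @` B) = s @` between lt A B.
Proof.
move=> [mono surj]; apply/seteqP; split=> [y [Ay yB]|_ [x [Ax xB] <-]].
  have [x xy] := surj y; exists x => //; split=> [a /(imageP s)/Ay|b /(imageP s)/yB];
  by rewrite -xy => /mono.
by split=> _ [a ? <-]; apply/mono; [apply: Ax|apply: xB].
Qed.

Lemma ordpres_strict G : (forall u v, G u -> G v -> lt u.1 v.1 -> lt u.2 v.2) ->
  (forall u v, G u -> G v -> u.1 = v.1 -> u.2 = v.2) -> ordpres lt G.
Proof.
move=> mono func u v Gu Gv; split; first exact: mono.
move=> uv2; case: (lt_tot lt_hom u.1 v.1) => // [/func|/mono] uv.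
  by have := uv Gu Gv => e; rewrite e in uv2; have := lt_irr lt_hom uv2.
by have := uv Gv Gu => ?; ord lt_hom.
Qed.

Lemma ordpres_func G x y y' : ordpres lt G -> G (x, y) -> G (x, y') -> y = y'.
Proof.
move=> Go Gy Gy'; have := Go _ _ Gy Gy'; have := Go _ _ Gy' Gy => /= e e'.
by case: (lt_tot lt_hom y y') => // [/e'|/e] /(lt_irr lt_hom).
Qed.

Lemma ordpres_sub G G0 : ordpres lt G -> G0 `<=` G -> ordpres lt G0.
Proof. by move=> Go G0G u v /G0G Gu /G0G Gv; apply: Go. Qed.

Lemma ordpres_converse G : ordpres lt G -> ordpres lt (converse G).
Proof. by move=> Go u v Gu Gv; rewrite (Go (u.2, u.1) (v.2, v.1)). Qed.

End Order.

(** * The game of finite length, confined to two regions *)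

Section Game.
Variables mu lam : Type.
Hypothesis mu_uncountable : ~ countable [set: mu].
Hypothesis lam_succ : is_card_succ mu lam.

Local Notation small A := (card_lt A [set: lam]).

Lemma small_sub T (A B : set T) : small B -> A `<=` B -> small A.
Proof.
move=> /(small_leP lam_succ) sB AB; apply/(small_leP lam_succ).
exact: card_le_trans (subset_card_le AB) sB.
Qed.

Lemma small_image T U (f : T -> U) (A : set T) : small A -> small (f @` A).
Proof.
move=> /(small_leP lam_succ) sA; apply/(small_leP lam_succ).
exact: card_le_trans (card_image_le _ _) sA.
Qed.

Lemma smallU T (A B : set T) : small A -> small B -> small (A `|` B).
Proof.
move=> /(small_leP lam_succ) sA /(small_leP lam_succ) sB.
apply/(small_leP lam_succ); apply: card_setU_le sA sB.
exact: infinite_mu.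
Qed.

Lemma small1 T (x : T) : small [set x].
Proof.
apply/(small_leP lam_succ).
have /infiniteP := infinite_mu mu_uncountable; apply: card_le_trans.
have <- : (fun=> x) @` [set 0] = [set x].
  by apply/seteqP; split=> [_ [_ _ <-]|_ ->] //; exists 0.
exact: card_le_trans (card_image_le _ _) (subset_card_le (@subsetT _ _)).
Qed.

Lemma small0 T : small (@set0 T).
Proof. exact/(small_leP lam_succ)/card_ge0. Qed.

(** [game lt n U V G] is the finite rank condition of length [n] for [G], with
    all moves in [U] and [V]: confining the moves allows each cut of a map to
    be studied on its own. *)
Fixpoint game (T : Type) (lt : T -> T -> Prop) (n : nat) (U V : set T)
    (G : set (T * T)) : Prop :=
  [/\ ordpres lt G, small G & G `<=` U `*` V] /\
  if n is m.+1 then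
    (forall C, small C -> C `<=` U -> exists G',
       [/\ G `<=` G', C `<=` fst @` G' & game lt m U V G']) /\
    (forall C, small C -> C `<=` V -> exists G',
       [/\ G `<=` G', C `<=` snd @` G' & game lt m U V G'])
  else True.

Definition equiv T (lt : T -> T -> Prop) n (U V : set T) := game lt n U V set0.

Section Basics.
Variables (T : Type) (lt : T -> T -> Prop).
Implicit Types (G : set (T * T)) (U V : set T).

Lemma game_base n U V G : game lt n U V G ->
  [/\ ordpres lt G, small G & G `<=` U `*` V].
Proof. by case: n => [|n] []. Qed.

Lemma game_sub n U V G G0 : game lt n U V G -> G0 `<=` G -> game lt n U V G0.
Proof.
move=> rG G0G; have [Go Gs GUV] := game_base rG.
have base : [/\ ordpres lt G0, small G0 & G0 `<=` U `*` V].
  split; first exact: ordpres_sub Go G0G.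
  - exact: small_sub Gs G0G.
  - exact: subset_trans G0G GUV.
case: n rG => [|n] [_ /= fb]; split=> //; case: fb => f b.
split=> C sC CU; [have [G' [GG' CG' rG']] := f _ sC CU|
  have [G' [GG' CG' rG']] := b _ sC CU];
  by exists G'; split=> //; apply: subset_trans GG'.
Qed.

Lemma equiv_game n U V G : game lt n U V G -> equiv lt n U V.
Proof. by move/game_sub; apply; apply: sub0set. Qed.

Lemma gameW n U V G : game lt n.+1 U V G -> game lt n U V G.
Proof.
elim: n G => [|n IH] G [base fb]; first by split.
split=> //; case: fb => f b; split=> C sC CU.
  by have [G' [GG' CG' /IH rG']] := f _ sC CU; exists G'.
by have [G' [GG' CG' /IH rG']] := b _ sC CU; exists G'.
Qed.

Lemma equivW n U V : equiv lt n.+1 U V -> equiv lt n U V.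
Proof. exact: gameW. Qed.

Lemma game_converse n U V G : game lt n U V G -> game lt n V U (converse G).
Proof.
elim: n G => [|n IH] G [[Go Gs GUV] fb].
  split=> //; split; first exact: ordpres_converse.
    apply: small_sub (small_image (fun u => (u.2, u.1)) Gs) _.
    by move=> [x y] Gyx; exists (y, x).
  by move=> [x y] /GUV[].
split; last first.
  case: fb => f b; split=> C sC CU.
    have [G' [GG' CG' /IH rG']] := b _ sC CU; exists (converse G'); split=> //.
      by move=> [x y] /GG'.
    by move=> x /CG'[[y z] Gyz <-]; exists (z, y).
  have [G' [GG' CG' /IH rG']] := f _ sC CU; exists (converse G'); split=> //.
    by move=> [x y] /GG'.
  by move=> x /CG'[[y z] Gyz <-]; exists (z, y).
split; first exact: ordpres_converse.
  apply: small_sub (small_image (fun u => (u.2, u.1)) Gs) _.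
  by move=> [x y] Gyx; exists (y, x).
by move=> [x y] /GUV[].
Qed.

Lemma equiv_sym n U V : equiv lt n U V -> equiv lt n V U.
Proof. by move=> /game_converse/equiv_game. Qed.

Lemma game_dual n U V G : game lt n U V G -> game (dual_lt lt) n U V G.
Proof.
elim: n G => [|n IH] G [[Go Gs GUV] fb].
  by split=> //; split=> // u v Gu Gv; apply: Go.
split; first by split=> // u v Gu Gv; apply: Go.
case: fb => f b; split=> C sC CU.
  by have [G' [GG' CG' /IH rG']] := f _ sC CU; exists G'.
by have [G' [GG' CG' /IH rG']] := b _ sC CU; exists G'.
Qed.

Lemma game_aut s n U V G : aut lt s -> game lt n U V G ->
  game lt n U (s @` V) ((fun u => (u.1, s u.2)) @` G).
Proof.
move=> [mono surj]; elim: n G => [|n IH] G [[Go Gs GUV] fb].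
  split=> //; split; first by move=> _ _ [u Gu <-] [v Gv <-] /=; rewrite mono; apply: Go.
    exact: small_image.
  by move=> _ [u /GUV[Uu Vu] <-]; split=> //=; exists u.2.
split; first split.
- by move=> _ _ [u Gu <-] [v Gv <-] /=; rewrite mono; apply: Go.
- exact: small_image.
- by move=> _ [u /GUV[Uu Vu] <-]; split=> //=; exists u.2.
case: fb => f b; split=> C sC CU.
  have [G' [GG' CG' /IH rG']] := f _ sC CU.
  exists ((fun u => (u.1, s u.2)) @` G'); split=> //; first exact: image_subset.
  by move=> x /CG'[u Gu <-]; exists (u.1, s u.2) => //; exists u.
have /choice[t tP] y : exists x, C y -> V x /\ s x = y.
  have [/CU[x Vx <-]|nC] := pselect (C y); first by exists x.
  by exists y.
have [|_ [y Cy <-]|G' [GG' CG' /IH rG']] := b (t @` C).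
- exact: small_image.
- by have [] := tP _ Cy.
exists ((fun u => (u.1, s u.2)) @` G'); split=> //; first exact: image_subset.
move=> y Cy; have [|u Gu uy] := CG' (t y); first by exists y.
by exists (u.1, s u.2) => /=; [exists u|rewrite uy (tP y Cy).2].
Qed.

Lemma equiv_aut s n U V : aut lt s -> equiv lt n U V -> equiv lt n U (s @` V).
Proof. by move=> saut /(game_aut saut)/equiv_game. Qed.

Lemma game_diag n U (S : set T) : small S -> S `<=` U ->
  game lt n U U ((fun x => (x, x)) @` S).
Proof.
elim: n S => [|n IH] S sS SU.
  split=> //; split; [by move=> _ _ [x _ <-] [y _ <-]|exact: small_image|].
  by move=> _ [x /SU Ux <-].
split.
  split; [by move=> _ _ [x _ <-] [y _ <-]|exact: small_image|].
  by move=> _ [x /SU Ux <-].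
split=> C sC CU; exists ((fun x => (x, x)) @` (S `|` C)); split.
- exact/image_subset/subsetUl.
- by move=> x Cx; exists (x, x) => //; exists x => //; right.
- by apply: IH; [apply: smallU|move=> x [/SU|/CU]].
- exact/image_subset/subsetUl.
- by move=> x Cx; exists (x, x) => //; exists x => //; right.
- by apply: IH; [apply: smallU|move=> x [/SU|/CU]].
Qed.

Lemma equiv_aut_image s n U : aut lt s -> equiv lt n U (s @` U).
Proof.
move=> saut; apply: equiv_aut => //.
exact: equiv_game (game_diag n (@small0 T) (@sub0set _ U)).
Qed.

(** Pairs below [A] and above [B] correspond to each other, so a play may be
    confined to the region that [A] and [B] delimit. *)
Lemma game_between n U V G (A B : set (T * T)) : game lt n U V G ->
  A `<=` G -> B `<=` G ->
  equiv lt n (U `&` between lt (fst @` A) (fst @` B))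
             (V `&` between lt (snd @` A) (snd @` B)).
Proof.
set U' := U `&` _; set V' := V `&` _ => rG AG BG.
suff : game lt n U' V' (G `&` U' `*` V') by apply: equiv_game.
have regions G' x y : ordpres lt G' -> G' `<=` U `*` V -> G `<=` G' ->
    G' (x, y) -> U' x <-> V' y.
  move=> Go GUV GG' Gxy; have [Ux Vy] := GUV _ Gxy.
  split=> -[_ [Ax xB]]; split=> //; split=> _ [u uAB <-].
  - by apply/(Go u (x, y)) => //; [exact/GG'/AG|apply: Ax; exists u].
  - by apply/(Go (x, y) u) => //; [exact/GG'/BG|apply: xB; exists u].
  - by apply/(Go u (x, y)) => //; [exact/GG'/AG|apply: Ax; exists u].
  - by apply/(Go (x, y) u) => //; [exact/GG'/BG|apply: xB; exists u].
elim: n G rG AG BG regions => [|n IH] G [[Go Gs GUV] fb] AG BG regions.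
  split=> //; split; first exact: ordpres_sub Go (@subIsetl _ _ _).
    exact: small_sub Gs (@subIsetl _ _ _).
  exact: subIsetr.
split.
  split; first exact: ordpres_sub Go (@subIsetl _ _ _).
    exact: small_sub Gs (@subIsetl _ _ _).
  exact: subIsetr.
case: fb => f b; split=> C sC CU.
  have [|G' [GG' CG' rG']] := f _ sC; first by move=> x /CU[].
  have [Go' _ GUV'] := game_base rG'.
  exists (G' `&` U' `*` V'); split; first by apply: setSI.
    move=> x Cx; have [[x' y] Gxy /= xx] := CG' _ Cx; subst x'.
    exists (x, y) => //; split=> //; split; first exact: CU.
    by apply/(regions G' x y) => //; apply: CU.
  apply: IH => // [||G'' x y Go'' GUV'' /(subset_trans GG')];
    [exact: subset_trans AG _|exact: subset_trans BG _|exact: regions].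
have [|G' [GG' CG' rG']] := b _ sC; first by move=> x /CU[].
have [Go' _ GUV'] := game_base rG'.
exists (G' `&` U' `*` V'); split; first by apply: setSI.
  move=> y Cy; have [[x y'] Gxy /= yy] := CG' _ Cy; subst y'.
  exists (x, y) => //; split=> //; split; last exact: CU.
  by apply/(regions G' x y) => //; apply: CU.
apply: IH => // [||G'' x y Go'' GUV'' /(subset_trans GG')];
  [exact: subset_trans AG _|exact: subset_trans BG _|exact: regions].
Qed.

End Basics.
End Game.

(** * Gluing games along the cuts of a map *)

Section Glue.
Variables mu lam : Type.
Hypothesis mu_uncountable : ~ countable [set: mu].
Hypothesis lam_succ : is_card_succ mu lam.
Local Notation small A := (card_lt A [set: lam]).
Local Notation game := (game lam).
Local Notation equiv := (equiv lam).
Variables (T : Type) (lt : T -> T -> Prop).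
Hypothesis lt_hom : homogeneous lt.
Implicit Types (G A B H : set (T * T)) (U V : set T).

Definition pcut G A B :=
  (forall u, G u <-> A u \/ B u) /\ forall u v, A u -> B v -> lt u.1 v.1.

Definition cuts_equiv n G := forall A B, pcut G A B ->
  equiv lt n (between lt (fst @` A) (fst @` B))
             (between lt (snd @` A) (snd @` B)).

(** Constraints that follow from [X] and [Y] may be dropped from [X'] and
    [Y']. *)
Lemma between_refine (X Y X' Y' X2 Y2 : set T) :
  X `<=` X' -> Y `<=` Y' -> X2 `<=` X' -> Y2 `<=` Y' ->
  (forall x, X' x -> X2 x \/ exists2 a, X a & ~ lt a x) ->
  (forall x, Y' x -> Y2 x \/ exists2 b, Y b & ~ lt x b) ->
  between lt X Y `&` between lt X2 Y2 = between lt X' Y'.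
Proof.
move=> XX YY X2X Y2Y X'P Y'P; apply/seteqP; split=> t.
  move=> [[Xt tY] [X2t tY2]]; split=> [x /X'P[/X2t//|[a /Xt at_ nax]]|
    y /Y'P[/tY2//|[b /tY tb nyb]]]; ord lt_hom.
by move=> [X't tY']; split; split=> ? ?; first [apply: X't|apply: tY']; auto.
Qed.

(** In each gap of [G] that [C] meets, the reply to [C] is the reply of the
    game confined to that gap. *)
Lemma cuts_equiv_forth n G C : ordpres lt G -> small G -> small C ->
  cuts_equiv n.+1 G -> exists G',
  [/\ G `<=` G', C `<=` fst @` G', ordpres lt G', small G' & cuts_equiv n G'].
Proof.
move=> Go Gs Cs Gcut.
have /choice[H HP] (AB : set (T * T) * set (T * T)) : exists K,
    pcut G AB.1 AB.2 ->
    game lt n (between lt (fst @` AB.1) (fst @` AB.2))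
      (between lt (snd @` AB.1) (snd @` AB.2)) K /\
    C `&` between lt (fst @` AB.1) (fst @` AB.2) `<=` fst @` K.
  case: AB => A B /=.
  have [cut|ncut] := pselect (pcut G A B); last by exists set0 => /ncut.
  have [_ [f _]] := Gcut _ _ cut.
  have [||K [_ CK rK]] := f (C `&` between lt (fst @` A) (fst @` B)).
  - exact: (small_sub lam_succ) Cs (@subIsetl _ _ _).
  - exact: subIsetr.
  by exists K.
pose Lo x := [set u | G u /\ lt u.1 x].
pose Hi x := [set u | G u /\ lt x u.1].
pose N := C `\` fst @` G.
have notin x u : N x -> G u -> u.1 <> x by move=> [_ nx] Gu ux; apply: nx; exists u.
have cutx x : N x -> pcut G (Lo x) (Hi x).
  move=> Nx; split=> [u|u v [_ ux] [_ xv]]; last by apply: (lt_tr lt_hom) ux xv.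
  split=> [Gu|[][]//].
  by case: (lt_tot lt_hom u.1 x) => [ux|/(notin _ _ Nx Gu)//|xu]; [left|right].
have inx x : N x -> between lt (fst @` Lo x) (fst @` Hi x) x.
  by move=> _; split=> _ [u [_ ux] <-].
have /choice[h hP] x : exists y, N x -> H (Lo x, Hi x) (x, y).
  have [Nx|nN] := pselect (N x); last by exists x => /nN.
  have [_ CH] := HP (_, _) (cutx _ Nx).
  have [|[x' y] Hy /= xx] := CH x; first by split; [case: Nx|apply: inx].
  by subst x'; exists y.
pose G' := G `|` (fun x => (x, h x)) @` N.
have GG' : G `<=` G' by apply: subsetUl.
have hin x : N x -> between lt (snd @` Lo x) (snd @` Hi x) (h x).
  move=> Nx; have [/game_base[_ _ sub] _] := HP (_, _) (cutx _ Nx).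
  by have [] := sub _ (hP _ Nx).
have G'mono u v : G' u -> G' v -> lt u.1 v.1 -> lt u.2 v.2.
  move=> [Gu|[x Nx <-]] [Gv|[x' Nx' <-]] /=; first by move/(Go u v Gu Gv).
  - by move=> ux; apply: (hin _ Nx').1; exists u.
  - by move=> ux; apply: (hin _ Nx).2; exists v.
  - move=> xx; have [[g [Gg xg gx]]|none] := pselect (exists g, [/\ G g, lt x g.1 & lt g.1 x']).
      by apply: (@lt_tr _ _ lt_hom g.2); [apply: (hin _ Nx).2|apply: (hin _ Nx').1]; exists g.
    have same g : G g -> lt g.1 x <-> lt g.1 x'.
      move=> Gg; split=> [gx|gx']; first exact: lt_tr gx xx.
      have nxg : ~ lt x g.1 by move=> xg; apply: none; exists g.
      have ngx := notin _ _ Nx Gg.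
      by clear -lt_hom ngx nxg; ord lt_hom.
    have same' g : G g -> lt x g.1 <-> lt x' g.1.
      move=> Gg; split=> [xg|xg']; last exact: lt_tr xg'.
      have nxg : ~ lt g.1 x' by move=> gx; apply: none; exists g.
      have ngx := notin _ _ Nx' Gg.
      by clear -lt_hom ngx nxg; ord lt_hom.
    have eLo : Lo x = Lo x' by apply/seteqP; split=> g [Gg /(same _ Gg)].
    have eHi : Hi x = Hi x' by apply/seteqP; split=> g [Gg /(same' _ Gg)].
    have [/game_base[Ho _ _] _] := HP (_, _) (cutx _ Nx).
    have := hP _ Nx'; rewrite -eLo -eHi => hx'.
    exact: (Ho _ _ (hP _ Nx) hx').1.
have G'o : ordpres lt G'.
  apply: ordpres_strict => // u v [Gu|[x Nx <-]] [Gv|[x' Nx' <-]] /= uv.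
  - by apply: (ordpres_func lt_hom Go (x := u.1)); [|rewrite uv]; rewrite -surjective_pairing.
  - by have := notin _ _ Nx' Gu.
  - by have := notin _ _ Nx Gv; rewrite uv.
  - by rewrite uv.
exists G'; split=> //.
- move=> x Cx; have [[u Gu <-]|nx] := pselect ((fst @` G) x).
    by exists u => //; left.
  by exists (x, h x) => //; right; exists x.
- apply: (smallU mu_uncountable lam_succ) => //; apply: (small_image lam_succ).
  exact: (small_sub lam_succ) Cs (@subDsetl _ _ _).
move=> A' B' [A'B' A'ltB'].
pose A := A' `&` G; pose B := B' `&` G.
have cutAB : pcut G A B.
  split=> [u|u v [Au _] [Bv _]]; last exact: A'ltB'.
  split=> [Gu|[][]//]; have /A'B'[] := GG' _ Gu; [by left|by right].
have [rH CH] := HP (A, B) cutAB; rewrite /= in rH CH.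
have same x : N x -> between lt (fst @` A) (fst @` B) x -> Lo x = A /\ Hi x = B.
  move=> Nx [Ax xB]; have Ax' u : A u -> lt u.1 x by move=> Au; apply: Ax; exists u.
  have xB' u : B u -> lt x u.1 by move=> Au; apply: xB; exists u.
  have [cAB _] := cutAB.
  split; apply/seteqP; split=> [u [Gu ux]|u ABu].
  - by have [//|/xB' ?] := (cAB u).1 Gu; exfalso; ord lt_hom.
  - by split; [case: ABu|apply: Ax'].
  - by have [/Ax' ?|//] := (cAB u).1 Gu; exfalso; ord lt_hom.
  - by split; [case: ABu|apply: xB'].
pose A2 := A' `&` H (A, B); pose B2 := B' `&` H (A, B).
have lower u : A' u -> A2 u \/ exists2 a, A a & ~ lt a.1 u.1.
  move=> A'u; have [Gu|[x Nx xu]] := (A'B' u).2 (or_introl A'u).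
    by right; exists u => //; apply: lt_irr.
  subst u; have [[a [Aa ax]]|nA] := pselect (exists a, A a /\ ~ lt a.1 x).
    by right; exists a.
  have [eA eB] : Lo x = A /\ Hi x = B.
    apply: same => //; split=> _ [v ABv <-].
      by apply: contrapT => nvx; apply: nA; exists v.
    by apply: (A'ltB' _ _ A'u); case: ABv.
  by left; split=> //; rewrite -eA -eB; apply: hP.
have up_to_block u : B' u -> B2 u \/ exists2 b, B b & ~ lt u.1 b.1.
  move=> B'u; have [Gu|[x Nx xu]] := (A'B' u).2 (or_intror B'u).
    by right; exists u => //; apply: lt_irr.
  subst u; have [[b [Bb bx]]|nB] := pselect (exists b, B b /\ ~ lt x b.1).
    by right; exists b.
  have [eA eB] : Lo x = A /\ Hi x = B.
    apply: same => //; split=> _ [v ABv <-].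
      by apply: A'ltB' B'u; case: ABv.
    by apply: contrapT => nvx; apply: nB; exists v.
  by left; split=> //; rewrite -eA -eB; apply: hP.
have AA' : A `<=` A' by apply: subIsetl.
have BB' : B `<=` B' by apply: subIsetl.
have A2A' : A2 `<=` A' by apply: subIsetl.
have B2B' : B2 `<=` B' by apply: subIsetl.
have G'A u : A' u -> G' u by move=> ?; apply/A'B'; left.
have G'B u : B' u -> G' u by move=> ?; apply/A'B'; right.
have -> : between lt (fst @` A') (fst @` B') =
    between lt (fst @` A) (fst @` B) `&` between lt (fst @` A2) (fst @` B2).
  apply/esym/between_refine; try exact: image_subset.
    move=> _ [u /lower[A2u|[a Aa nau]] <-]; first by left; exists u.
    by right; exists a.1 => //; exists a.
  move=> _ [u /up_to_block[B2u|[b Bb nbu]] <-]; first by left; exists u.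
  by right; exists b.1 => //; exists b.
have -> : between lt (snd @` A') (snd @` B') =
    between lt (snd @` A) (snd @` B) `&` between lt (snd @` A2) (snd @` B2).
  apply/esym/between_refine; try exact: image_subset.
    move=> _ [u A'u <-]; have [A2u|[a Aa nau]] := lower _ A'u; first by left; exists u.
    right; exists a.2; first by exists a.
    by rewrite -(G'o a u (GG' _ Aa.2) (G'A _ A'u)).
  move=> _ [u B'u <-]; have [B2u|[b Bb nbu]] := up_to_block _ B'u; first by left; exists u.
  right; exists b.2; first by exists b.
  by rewrite -(G'o u b (G'B _ B'u) (GG' _ Bb.2)).
exact: (game_between lam_succ rH (@subIsetr _ A' _) (@subIsetr _ B' _)).
Qed.

Lemma converse_image A : (fst @` converse A = snd @` A) * (snd @` converse A = fst @` A).
Proof.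
split; apply/seteqP; split=> [_ [[x y] Ayx <-]|_ [[x y] Axy <-]] /=.
- by exists (y, x).
- by exists (y, x).
- by exists (y, x).
- by exists (y, x).
Qed.

Lemma converseK A : converse (converse A) = A.
Proof. by apply/seteqP; split=> -[]. Qed.

Lemma small_converse G : small G -> small (converse G).
Proof.
move=> Gs; apply: (small_sub lam_succ) (small_image lam_succ (fun u => (u.2, u.1)) Gs) _.
by move=> [x y] Gyx; exists (y, x).
Qed.

Lemma cuts_equiv_converse n G : ordpres lt G -> cuts_equiv n G -> cuts_equiv n (converse G).
Proof.
move=> Go Gcut A B [GAB AB]; rewrite -(converseK A) -(converseK B).
have GAB' u : G u <-> converse A u \/ converse B u by case: u => x y; exact: (GAB (y, x)).
have : pcut G (converse A) (converse B).
  split=> // u v Au Bv; have [Gu Gv] : G u /\ G v.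
    by split; apply/GAB'; [left|right].
  apply/(Go u v) => //.
  exact: (AB (u.2, u.1) (v.2, v.1) Au Bv).
move: (converse A) (converse B) => A' B' /Gcut/(equiv_sym lam_succ).
by rewrite !converse_image.
Qed.

(** Conversely to [game_between], the game on [G] reduces to the games in the
    gaps of [G]: a reply in each of them, put together, is a reply to [G]. *)
Lemma game_cuts n G : ordpres lt G -> small G -> cuts_equiv n G -> game lt n setT setT G.
Proof.
elim: n G => [|n IH] G Go Gs Gcut; first by [].
split=> //; split=> C sC _.
  have [G' [GG' CG' G'o G's G'cut]] := cuts_equiv_forth Go Gs sC Gcut.
  by exists G'; split=> //; apply: IH.
have [G' [GG' CG' G'o G's G'cut]] := cuts_equiv_forth (ordpres_converse Go)
  (small_converse Gs) sC (cuts_equiv_converse Go Gcut).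
exists (converse G'); split; first by move=> [x y] /(GG' (y, x)).
  by rewrite converse_image.
by apply: IH; [apply: ordpres_converse|apply: small_converse|apply: cuts_equiv_converse].
Qed.

(** The move [z] is answered by some [w], and the play that follows may be
    confined to the points above [z] and [w]. *)
Lemma equiv_split n U V z : equiv lt n.+1 U V -> U z -> exists2 w, V w &
  equiv lt n (U `&` [set x | lt z x]) (V `&` [set y | lt w y]).
Proof.
move=> [_ [f _]] Uz; have [||G [_ zG rG]] := f [set z]; [|by move=> _ ->|].
  exact: (small1 mu_uncountable lam_succ).
have [_ _ GUV] := game_base rG.
have [[z' w] Gzw /= zz] := zG z erefl; subst z'; exists w; first by case: (GUV _ Gzw).
have := game_between lam_succ rG (A := [set (z, w)]) (B := set0).
have -> : between lt (fst @` [set (z, w)]) (fst @` (set0 : set (T * T))) = [set x | lt z x].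
  apply/seteqP; split=> [x [zx _]|x zx]; first by apply: zx; exists (z, w).
  by split=> _ [u uE <-] //; rewrite uE.
have -> : between lt (snd @` [set (z, w)]) (snd @` (set0 : set (T * T))) = [set x | lt w x].
  apply/seteqP; split=> [x [wx _]|x wx]; first by apply: wx; exists (z, w).
  by split=> _ [u uE <-] //; rewrite uE.
by apply=> // _ ->.
Qed.

Lemma equiv_nonempty n U V x : equiv lt n.+1 U V -> U x -> exists y, V y.
Proof. by move=> /equiv_split e /e[y]; exists y. Qed.

End Glue.

(** * Good cuts and blocks *)

Section Replies.
Variables (lam T : Type) (lt : T -> T -> Prop) (C : set T) (g : nat -> T -> T).

Definition cut (A B : set T) :=
  (forall c, C c <-> A c \/ B c) /\ forall a b, A a -> B b -> lt a b.

(** For each [n], [g n] stands for a reply on [C] to a map of high finite rank.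
    The two spare moves serve beyond a block that is not settled: one pairs two
    points there, the other one shows that more points follow. *)
Record replies : Prop := Replies {
  replies_mono : forall n x y, C x -> C y -> lt x y -> lt (g n x) (g n y);
  replies_cut : forall n A B, cut A B ->
    equiv lam lt n.+2 (between lt A B) (between lt (g n @` A) (g n @` B)) }.

(** The replies to [A] are cofinal in each other: they all determine the same
    cut of [T] above their values on [A]. *)
Definition settled (A : set T) :=
  forall n m a, A a -> exists2 a', A a' & ~ lt (g m a') (g n a).
End Replies.

Section BlockDefinitions.
Variables (T : Type) (lt : T -> T -> Prop) (C : set T) (g : nat -> T -> T).

(** It is enough that the replies agree on one side of the cut: they then
    interleave, in the sense of [good_cut_weak]. *)
Definition good_cut A B := cut lt C A B /\ (settled lt g A \/ settled (dual_lt lt) g B).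

(** Between two points of a block the replies need not agree in any sense, and
    the final map will not follow them. *)
Definition same_block p q :=
  [/\ C p, C q & forall A B, good_cut A B -> (A p <-> A q) /\ (B p <-> B q)].

Definition up_to_block p : set T := [set c | C c /\ exists2 q, same_block p q & ~ lt q c].
Definition above_block p : set T := [set c | C c /\ forall q, same_block p q -> lt q c].
End BlockDefinitions.

(** A candidate [H] for the final map on the upper half of the block of [p].
    If the block is settled at its upper end, [H] follows the replies there
    ([half_le], [half_cofinal]). Otherwise [H] has one greatest pair, lying
    beyond the block, above which the game goes on as for the replies
    ([half_top]). Inside, [H] looks like an automorphism ([half_aut]). *)
Record half_block lam T (lt : T -> T -> Prop) (C : set T) (g : nat -> T -> T) p
    (H : set (T * T)) : Prop := Half {
  half_base : H (p, g 0 p);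
  half_ge : forall u, H u -> ~ lt u.1 p /\ ~ lt u.2 (g 0 p);
  half_dom : forall q, same_block lt C g p q -> ~ lt q p -> exists y, H (q, y);
  half_small : exists z, forall u, H u -> same_block lt C g p u.1 \/ u.1 = z;
  half_above : forall u c, H u -> above_block lt C g p c ->
    lt u.1 c /\ forall n, lt u.2 (g n c);
  half_le : settled lt g (up_to_block lt C g p) -> forall u, H u ->
    exists2 q, same_block lt C g p q & ~ lt q u.1 /\ ~ lt (g 0 q) u.2;
  half_cofinal : settled lt g (up_to_block lt C g p) -> forall q, same_block lt C g p q ->
    exists2 u, H u & ~ lt u.1 q /\ ~ lt u.2 (g 0 q);
  half_top : ~ settled lt g (up_to_block lt C g p) -> exists u,
    [/\ H u, forall v, H v -> ~ lt u.1 v.1 /\ ~ lt u.2 v.2 &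
     forall n, equiv lam lt n (between lt [set u.1] (above_block lt C g p))
                 (between lt [set u.2] (g n @` above_block lt C g p))];
  half_aut : forall v, H v -> exists2 s, aut lt s &
    forall w, H w -> ~ lt v.1 w.1 -> w.2 = s w.1 }.

Section Cuts.
Variables (T : Type) (lt : T -> T -> Prop) (C : set T) (g : nat -> T -> T).
Hypothesis lt_hom : homogeneous lt.
Local Notation dcut := (cut (dual_lt lt) C).
Local Notation dgood := (good_cut (dual_lt lt) C g).
Local Notation dsame_block := (same_block (dual_lt lt) C g).
Local Notation cut := (cut lt C).
Local Notation good_cut := (good_cut lt C g).
Local Notation same_block := (same_block lt C g).
Local Notation up_to_block := (up_to_block lt C g).
Local Notation above_block := (above_block lt C g).
Local Notation settled := (settled lt g).
Implicit Types A B : set T.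

Lemma cut_disj A B x : cut A B -> A x -> B x -> False.
Proof. by move=> [_ AB] Ax /(AB _ _ Ax) /(lt_irr lt_hom). Qed.

Lemma cut_dual A B : dcut A B <-> cut B A.
Proof.
by split=> -[CAB AB]; split=> [c|a b Aa Bb]; by [rewrite CAB orC|apply: AB].
Qed.

Lemma good_cut_dual A B : dgood A B <-> good_cut B A.
Proof. by split=> -[/cut_dual ? [?|?]]; split=> //; [right|left|right|left]. Qed.

Lemma same_block_dual p q : dsame_block p q <-> same_block p q.
Proof.
by split=> -[Cp Cq same_block]; split=> // A B /good_cut_dual/same_block[].
Qed.

Lemma cut_mem A B x : cut A B -> C x -> A x \/ B x.
Proof. by move=> [CAB _] /CAB. Qed.

Lemma cut_rest A B A' B' : cut A B -> cut A' B' -> A = A' -> B = B'.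
Proof.
move=> cAB cAB' eA; subst A'; apply/seteqP; split=> x Bx.
  have /cAB'.1[Ax|//] : C x by apply/cAB.1; right.
  by have := cut_disj cAB Ax Bx.
have /cAB.1[Ax|//] : C x by apply/cAB'.1; right.
by have := cut_disj cAB' Ax Bx.
Qed.

Lemma same_block_refl p : C p -> same_block p p.
Proof. by []. Qed.

Lemma same_block_sym p q : same_block p q -> same_block q p.
Proof.
move=> [Cp Cq e]; split=> // A B /e[e1 e2].
by rewrite e1 e2.
Qed.

Lemma same_block_trans p q r : same_block p q -> same_block q r -> same_block p r.
Proof.
move=> [Cp Cq e] [_ Cr e']; split=> // A B gAB.
have [e1 e2] := e _ _ gAB; have [e3 e4] := e' _ _ gAB.
by rewrite e1 e2 e3 e4.
Qed.

Lemma not_same_block p q : C p -> C q -> lt p q -> ~ same_block p q ->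
  exists A B, [/\ good_cut A B, A p & B q].
Proof.
move=> Cp Cq pq; apply: contra_notP => none; split=> // A B gAB.
have AB := gAB.1; have [Ap|Bp] := cut_mem AB Cp.
  have [Aq|Bq] := cut_mem AB Cq.
    by split; split=> // Bx; exfalso; first [exact: cut_disj AB Ap Bx|exact: cut_disj AB Aq Bx].
  by exfalso; apply: none; exists A, B.
have [Aq|Bq] := cut_mem AB Cq.
  by have := AB.2 _ _ Aq Bp => ?; exfalso; ord lt_hom.
by split; split=> // Ax; exfalso; first [exact: cut_disj AB Ax Bp|exact: cut_disj AB Ax Bq].
Qed.

Lemma same_block_convex p q r : same_block p r -> lt p q -> lt q r -> C q -> same_block p q.
Proof.
move=> [Cp Cr e] pq qr Cq; apply: contrapT => npq.
have [A [B [gAB Ap Bq]]] := not_same_block Cp Cq pq npq.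
have Ar := (e _ _ gAB).1.1 Ap.
by have := gAB.1.2 _ _ Ar Bq => ?; ord lt_hom.
Qed.

Lemma up_to_block_self p : C p -> up_to_block p p.
Proof. by move=> Cp; split=> //; exists p => //; apply: lt_irr. Qed.

Lemma same_block_upper p q : same_block p q -> up_to_block p q.
Proof. by move=> pq; case: (pq) => _ Cq _; split=> //; exists q => //; apply: lt_irr. Qed.

Lemma up_to_block_cut p : cut (up_to_block p) (above_block p).
Proof.
split=> [c|a b [_ [q pq qa]] [_ /(_ _ pq) qb]]; last by ord lt_hom.
split=> [Cc|[][]//].
have [[q pq qc]|none] := pselect (exists2 q, same_block p q & ~ lt q c).
  by left; split=> //; exists q.
by right; split=> // q pq; apply: contrapT => qc; apply: none; exists q.
Qed.

Lemma same_block_lt p q r s : same_block p q -> same_block r s -> lt p r ->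
  ~ same_block p r -> lt q s.
Proof.
move=> pq rs pr npr; have [_ Cq epq] := pq; have [Cr Cs ers] := rs.
have [Cp _ _] := pq.
have [A [B [gAB Ap Br]]] := not_same_block Cp Cr pr npr.
apply: gAB.1.2; first exact: (epq _ _ gAB).1.1.
exact: (ers _ _ gAB).2.1.
Qed.

Lemma above_block_lt p q : C p -> C q -> lt p q -> ~ same_block p q -> above_block p q.
Proof.
move=> Cp Cq pq npq; split=> // q' pq'.
exact: same_block_lt pq' (same_block_refl Cq) pq npq.
Qed.

Lemma above_block_nsim p q : above_block p q -> ~ same_block p q.
Proof. by move=> [_ r] /r/(lt_irr lt_hom). Qed.

Hypothesis mono : forall n x y, C x -> C y -> lt x y -> lt (g n x) (g n y).

Lemma mono_le n x y : C x -> C y -> ~ lt y x -> ~ lt (g n y) (g n x).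
Proof.
move=> Cx Cy yx gyx; case: (lt_tot lt_hom x y) => [xy|xy|//].
  by have := mono n Cx Cy xy => ?; ord lt_hom.
by subst; have := lt_irr lt_hom gyx.
Qed.

Lemma good_cut_weak A B n m a b : good_cut A B -> A a -> B b -> lt (g n a) (g m b).
Proof.
move=> [[CAB AB] sAB] Aa Bb; have [Ca Cb] : C a /\ C b.
  by split; apply/CAB; [left|right].
case: sAB => sAB.
  have [a' Aa' na'] := sAB n m a Aa; have Ca' : C a' by apply/CAB; left.
  by have := mono m Ca' Cb (AB _ _ Aa' Bb) => ?; ord lt_hom.
have [b' Bb' nb'] := sAB m n b Bb; have Cb' : C b' by apply/CAB; right.
by have := mono n Ca Cb' (AB _ _ Aa Bb') => ?; rewrite /dual_lt in nb'; ord lt_hom.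
Qed.

(** If [a] and [a'] are separated by a good cut then every reply sends [a]
    below where any other one sends [a'], so [a'] bounds all replies to [a]. *)
Lemma settled_strict A : (forall a, A a -> exists A1 B1 a',
  [/\ good_cut A1 B1, A1 a, A a' & B1 a']) -> settled A.
Proof.
move=> strict n m a /strict[A1 [B1 [a' [gAB Aa Aa' Ba']]]]; exists a' => //.
by have := good_cut_weak n m gAB Aa Ba' => ?; ord lt_hom.
Qed.

(** A strictly increasing union of good cuts is settled from below, since
    between two of them the different replies interleave. *)
Lemma good_cut_union A B : cut A B ->
  (forall a, A a -> exists A1 B1, [/\ good_cut A1 B1, A1 a & A1 `<=` A]) -> good_cut A B.
Proof.
move=> cAB uA; have [strict|/existsNP[a]] := pselect (forall a, A a ->
    exists A1 B1 a', [/\ good_cut A1 B1, A1 a, A a' & B1 a']).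
  by split=> //; left; apply: settled_strict.
move=> /not_implyP[Aa none]; have [A1 [B1 [gAB A1a A1A]]] := uA _ Aa.
have eA : A1 = A.
  apply/seteqP; split=> // x Ax; have Cx : C x by apply/cAB.1; left.
  have [//|B1x] := cut_mem gAB.1 Cx.
  by exfalso; apply: none; exists A1, B1, x.
by rewrite -eA -(cut_rest gAB.1 cAB eA).
Qed.

End Cuts.

Section Blocks.
Variables mu lam : Type.
Hypothesis mu_uncountable : ~ countable [set: mu].
Hypothesis lam_succ : is_card_succ mu lam.
Variables (T : Type) (lt : T -> T -> Prop) (C : set T) (g : nat -> T -> T).
Hypothesis lt_hom : homogeneous lt.
Hypothesis g_replies : replies lam lt C g.
Local Notation cut := (cut lt C).
Local Notation good_cut := (good_cut lt C g).
Local Notation same_block := (same_block lt C g).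
Local Notation up_to_block := (up_to_block lt C g).
Local Notation above_block := (above_block lt C g).
Local Notation settled := (settled lt g).
Implicit Types A B : set T.

Let mono := replies_mono g_replies.

Lemma between_dual (A B : set T) : between (dual_lt lt) A B = between lt B A.
Proof. by apply/seteqP; split=> x []. Qed.

Lemma replies_dual : replies lam (dual_lt lt) C g.
Proof.
split=> [n x y Cx Cy|n A B /cut_dual]; first exact: mono.
by move=> /(replies_cut g_replies n)/game_dual; rewrite !between_dual.
Qed.

(** The part of [C] above the block is a union of upper parts of good cuts, so
    the dual of [good_cut_union] applies. *)
Lemma up_to_block_good p : C p -> good_cut (up_to_block p) (above_block p).
Proof.
move=> Cp; apply/good_cut_dual.
apply: (good_cut_union (homogeneous_dual lt_hom)); first exact: replies_mono replies_dual.
  exact/cut_dual/up_to_block_cut.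
move=> b rb; have [Cb pb] := rb.
have ltpb : lt p b by apply: pb; apply: same_block_refl.
have [A1 [B1 [gAB Ap Bb]]] := not_same_block lt_hom Cp Cb ltpb (above_block_nsim lt_hom rb).
exists B1, A1; split=> //; first exact/good_cut_dual.
move=> c B1c; split; first by apply/gAB.1.1; right.
by move=> q [_ _ e]; apply: gAB.1.2 => //; apply/(e _ _ gAB).1.
Qed.

(** A settled block has countable cofinality: otherwise one could climb past
    any countable set of replies, countably often, and the supremum of this
    climb would be a good cut splitting the block. *)
Lemma block_cofinal p : C p -> settled (up_to_block p) -> exists s : nat -> T,
  [/\ s 0 = p, forall i, same_block p (s i), forall i, ~ lt (s i.+1) (s i) &
   forall q, same_block p q -> exists i, ~ lt (s i) q].
Proof.
move=> Cp settledp.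
have [[t [tsim tcof]]|nocof] := pselect (exists t : nat -> T,
    (forall i, same_block p (t i)) /\ forall q, same_block p q -> exists i, ~ lt (t i) q).
  pose mx x y := if pselect (lt x y) then y else x.
  have mxl x y : ~ lt (mx x y) x.
    by rewrite /mx; case: pselect => /= ? ?; ord lt_hom.
  have mxr x y : ~ lt (mx x y) y.
    by rewrite /mx; case: pselect => /= ? ?; ord lt_hom.
  pose s := fix s i := if i is j.+1 then mx (s j) (t j) else p.
  exists s; split=> // [i|i|q /tcof[i ti]].
  - elim: i => [|i IH] /=; first exact: same_block_refl.
    by rewrite {1}/mx; case: pselect => /= _; [apply: tsim|apply: IH].
  - exact: mxl.
  - by exists i.+1 => /= ?; have := @mxr (s i) (t i) => ?; ord lt_hom.
have bounded (t : nat -> T) : (forall i, same_block p (t i)) ->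
    exists2 q, same_block p q & forall i, lt (t i) q.
  move=> tsim; apply: contrapT => nob; apply: nocof; exists t; split=> // q pq.
  apply: contrapT => noi; apply: nob; exists q => // i.
  by apply: contrapT => ti; apply: noi; exists i.
have /choice[next nextP] q : exists q', same_block p q -> [/\ same_block p q', lt q q' &
    forall n m, lt (g n q) (g m q')].
  have [pq|npq] := pselect (same_block p q); last by exists q.
  have Cq : C q by case: pq.
  have /choice[t tP] i : exists r, same_block p r /\ if unpickle i is Some nm then
      ~ lt (g nm.2 r) (g nm.1 q) else r = q.
    case: (unpickle i) => [[n m]|]; last by exists q.
    have [a [Ca [r pr ra]] na] := settledp n m q (same_block_upper lt_hom pq).
    exists r; split=> //=; have Cr : C r by case: pr.
    by have := mono_le (n := m) lt_hom mono Ca Cr ra => ?; ord lt_hom.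
  have [q1 pq1 tq1] := bounded t (fun i => (tP i).1).
  have [q2 pq2 tq2] := bounded (fun=> q) (fun=> pq).
  have [q' [pq' qq' tq']] : exists q', [/\ same_block p q', lt q q' & forall i, lt (t i) q'].
    have [lt12|nlt] := pselect (lt q1 q2).
      exists q2; split=> // [|i]; first exact: (tq2 0).
      exact: lt_tr (tq1 i) lt12.
    exists q1; split=> //; have := tq2 0 => ?; ord lt_hom.
  exists q' => _; split=> // n m; have [tsim] := tP (pickle (n, m)).
  rewrite pickleK /= => tge; have Cq' : C q' by case: pq'.
  have Ct : C (t (pickle (n, m))) by case: tsim.
  by have := mono m Ct Cq' (tq' _) => ?; ord lt_hom.
pose s := fix s i := if i is j.+1 then next (s j) else p.
have ssim i : same_block p (s i).
  by elim: i => [|i IH] /=; [apply: same_block_refl|case: (nextP _ IH)].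
have [q pq sq] := bounded s ssim.
pose A1 := [set c | C c /\ exists i, ~ lt (s i) c].
pose B1 := [set c | C c /\ forall i, lt (s i) c].
have cAB : cut A1 B1.
  split=> [c|a b [_ [i sia]] [_ /(_ i)]]; last by move=> ?; ord lt_hom.
  split=> [Cc|[][]//]; have [[i sic]|none] := pselect (exists i, ~ lt (s i) c).
    by left; split=> //; exists i.
  by right; split=> // i; apply: contrapT => sic; apply: none; exists i.
have gAB : good_cut A1 B1.
  split=> //; left=> n m a [Ca [i sia]]; have Csi : C (s i) by case: (ssim i).
  exists (s i.+1); first by split; [case: (ssim i.+1)|exists i.+1; apply: lt_irr].
  have [_ _ /(_ n m) ?] := nextP _ (ssim i).
  by have := mono_le (n := n) lt_hom mono Ca Csi sia => ? /= ?; ord lt_hom.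
have A1p : A1 p by split=> //; exists 0; apply: lt_irr.
have [_ Cq e] := pq; exfalso; have [_ [i]] := (e _ _ gAB).1.1 A1p.
by apply; apply: sq.
Qed.

End Blocks.

(** * The map on one half of a block *)

Section HalfBlocks.
Variables mu lam : Type.
Hypothesis mu_uncountable : ~ countable [set: mu].
Hypothesis lam_succ : is_card_succ mu lam.
Variables (T : Type) (lt : T -> T -> Prop) (C : set T) (g : nat -> T -> T).
Hypothesis lt_hom : homogeneous lt.
Hypothesis g_replies : replies lam lt C g.
Local Notation good_cut := (good_cut lt C g).
Local Notation same_block := (same_block lt C g).
Local Notation up_to_block := (up_to_block lt C g).
Local Notation above_block := (above_block lt C g).
Local Notation settled_dual := (settled (dual_lt lt) g).
Local Notation settled := (settled lt g).
Local Notation equiv := (equiv lam).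
Local Notation half_block := (half_block lam lt C g).
Implicit Types A B : set T.

Let mono := replies_mono g_replies.

(** Climbing a countable ladder [s] through the block, automorphisms that send
    [s i] to [g 0 (s i)] are adjusted step by step; no limit step occurs before
    the end of the block, where [g 0] is correct. *)
Lemma half_settled p : C p -> settled (up_to_block p) -> exists H, half_block p H.
Proof.
move=> Cp settledp.
have [s [s0 ssim sincr scof]] := block_cofinal lt_hom g_replies Cp settledp.
have Cs i : C (s i) by case: (ssim i).
have sle i j : i <= j -> ~ lt (s j) (s i).
  elim: j => [|j IH]; first by rewrite leqn0 => /eqP ->; apply: lt_irr.
  rewrite leq_eqVlt => /orP[/eqP ->|/IH ?]; first exact: lt_irr.
  by have := sincr j => ?; ord lt_hom.
(* [t i] realizes the ladder up to [s i]; the next one differs from it above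
   [s i] only, so the values at a given point stabilize. *)
have /choice[F FP] (i_t : nat * (T -> T)) : exists t', aut lt i_t.2 ->
    i_t.2 (s i_t.1) = g 0 (s i_t.1) ->
    [/\ aut lt t', t' (s i_t.1.+1) = g 0 (s i_t.1.+1) &
     forall x, ~ lt (s i_t.1) x -> t' x = i_t.2 x].
  case: i_t => i t /=; case: (lt_tot lt_hom (s i) (s i.+1)) => [si|si|/sincr//].
    have [taut|ntaut] := pselect (aut lt t); last by exists t.
    have [ti|nti] := pselect (t (s i) = g 0 (s i)); last by exists t.
    by have [t' t'P] := aut_extend lt_hom taut ti si (mono 0 (Cs i) (Cs i.+1) si); exists t'.
  by exists t; rewrite -si.
have [t0 t0aut t0p] := aut_transitive lt_hom p (g 0 p).
pose t := fix t i := if i is j.+1 then F (j, t j) else t0.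
have tP i : aut lt (t i) /\ t i (s i) = g 0 (s i).
  elim: i => [|i [IH1 IH2]] /=; first by rewrite s0.
  by have [] := FP (i, t i) IH1 IH2.
have tS i x : ~ lt (s i) x -> t i.+1 x = t i x.
  by have [_ _ e /e] := FP (i, t i) (tP i).1 (tP i).2.
have tle i j x : i <= j -> ~ lt (s i) x -> t j x = t i x.
  move=> ij six; elim: j ij => [|j IH]; first by rewrite leqn0 => /eqP ->.
  rewrite leq_eqVlt => /orP[/eqP ->//|ij]; rewrite tS ?IH //.
  by have := sle i j ij => ?; ord lt_hom.
have tcoh i j x : ~ lt (s i) x -> ~ lt (s j) x -> t j x = t i x.
  by move=> si sj; case: (leqP i j) => [|/ltnW] ij; [|apply/esym]; apply: tle.
have tp i : t i p = g 0 p.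
  by rewrite (@tle 0 i) //= ?s0 //; apply: lt_irr.
pose H : set (T * T) := [set u | [/\ same_block p u.1, ~ lt u.1 p &
  exists2 i, ~ lt (s i) u.1 & u.2 = t i u.1]].
have tmono i x y : ~ lt x y -> ~ lt (t i x) (t i y) by rewrite ((tP i).1.1).
exists H; split.
- by split=> //=; [apply: lt_irr|exists 0; rewrite ?s0 ?tp //; apply: lt_irr].
- by move=> u [pu up [i iu ->]]; split=> //; rewrite -(tp i); apply: tmono.
- by move=> q pq qp; have [i iq] := scof _ pq; exists (t i q); split=> //; exists i.
- by exists p => u [pu _ _]; left.
- move=> u c [pu up [i iu ->]] rc; have [Cc rcq] := rc.
  split=> [|n]; first exact: rcq.
  have := tmono i _ _ iu; rewrite (tP i).2 => ?.
  have := good_cut_weak lt_hom mono 0 n (up_to_block_good lt_hom g_replies Cp)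
    (same_block_upper lt_hom (ssim i)) rc => ?.
  by ord lt_hom.
- move=> _ u [pu up [i iu ->]]; exists (s i); first exact: ssim.
  by split=> //; rewrite -(tP i).2; apply: tmono.
- move=> _ q pq; have [i iq] := scof _ pq; have Cq : C q by case: pq.
  exists (s i, g 0 (s i)); last by split=> //=; apply: (mono_le lt_hom mono).
  split=> //=; first by rewrite -s0; apply: sle.
  by exists i; [apply: lt_irr|rewrite (tP i).2].
- by move=> /(_ settledp).
- move=> v [_ _ [i iv _]]; exists (t i); first by case: (tP i).
  by move=> w [_ _ [j jw ->]] vw; apply: tcoh => // ?; ord lt_hom.
Qed.

(** When the block is not settled, two of the replies overlap beyond it; the
    overlap leaves room for one extra pair [(z, w)], beyond which the game
    goes on as in the replies. *)
Lemma half_unsettled p : C p -> ~ settled (up_to_block p) -> exists H, half_block p H.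
Proof.
move=> Cp nsettled; set A := up_to_block p; set B := above_block p.
have gAB : good_cut A B := up_to_block_good lt_hom g_replies Cp.
have cAB := gAB.1; have Ap : A p := up_to_block_self g lt_hom Cp.
have settledB : settled_dual B by case: gAB => _ [].
have weak n m a b : A a -> B b -> lt (g n a) (g m b).
  exact: (good_cut_weak lt_hom mono n m gAB).
(* The reply [g m] keeps all of [A] strictly below a value [y] of [g k]. *)
have [y [m [k [a [Aa yE yA py]]]]] : exists y m k a,
    [/\ A a, y = g k a, forall a', A a' -> lt (g m a') y & ~ lt y (g 0 p)].
  have /existsNP[n /existsNP[m /existsNP[a /not_implyP[Aa nomax]]]] := nsettled.
  have gt a' : A a' -> lt (g m a') (g n a).
    by move=> Aa'; apply: contrapT => na'; apply: nomax; exists a'.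
  have [ltp|nlt] := pselect (lt (g n a) (g 0 p)).
    exists (g 0 p), m, 0, p; split=> //; last exact: lt_irr.
    by move=> a' /gt ?; ord lt_hom.
  by exists (g n a), m, n, a.
pose Z := between lt A B; pose W n := between lt (g n @` A) (g n @` B).
have ZW n : equiv lt n.+2 Z (W n) := replies_cut g_replies n cAB.
have yB n b : B b -> lt y (g n b) by move=> Bb; rewrite yE; apply: weak.
have Wy : W m y by split=> _ [c ? <-]; [apply: yA|apply: yB].
have [z0 Zz0] := equiv_nonempty mu_uncountable lam_succ (equiv_sym lam_succ (ZW m)) Wy.
have [y' Wy'] := equiv_nonempty mu_uncountable lam_succ (ZW k) Zz0.
have yy' : lt y y' by rewrite yE; apply: Wy'.1; exists a.
have y'B n b : B b -> lt y' (g n b).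
  move=> Bb; have [b' Bb' nb'] := settledB n k b Bb; rewrite /dual_lt in nb'.
  have : lt y' (g k b') by apply: Wy'.2; exists b'.
  by move=> ?; ord lt_hom.
(* The region of [g k] lies above [y] and, since [B] is settled, below every
   reply to [B]; hence [y] and [y'] both belong to the region of [g m]. *)
have [w yw wy'] := lt_dense lt_hom yy'.
have Ww : W m w.
  split=> _ [c Ac <-]; first by apply: (lt_tr lt_hom (yA _ Ac)).
  exact: (lt_tr lt_hom wy' (y'B m _ Ac)).
have [z Zz Ezw] := equiv_split mu_uncountable lam_succ (equiv_sym lam_succ (ZW m)) Ww.
have [z' [Zz' zz']] : exists z', Z z' /\ lt z z'.
  have Wy'' : (W m `&` [set y | lt w y]) y'.
    split=> //; split=> _ [c Ac <-]; last exact: y'B.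
    exact: (lt_tr lt_hom (lt_tr lt_hom (yA _ Ac) yw) wy').
  by have [z' []] := equiv_nonempty mu_uncountable lam_succ Ezw Wy''; exists z'.
have pz : lt p z by apply: Zz.1.
have pw : lt (g 0 p) w by ord lt_hom.
have [s [saut sp sz]] := aut_two lt_hom pz pw.
pose H : set (T * T) := [set u | (same_block p u.1 /\ ~ lt u.1 p \/ u.1 = z) /\ u.2 = s u.1].
have smono x x' : ~ lt x x' -> ~ lt (s x) (s x') by rewrite saut.1.
have Hz u : H u -> ~ lt z u.1.
  move=> [[[pu _]|->] _]; last exact: lt_irr.
  by have := Zz.1 _ (same_block_upper lt_hom pu) => ?; ord lt_hom.
exists H; split.
- by split=> //=; left; split; [apply: same_block_refl|apply: lt_irr].
- move=> u [uH ->]; have pu : ~ lt u.1 p.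
    by case: uH => [[]//|->]; ord lt_hom.
  by split=> //; rewrite -sp; apply: smono.
- by move=> q pq qp; exists (s q); split=> //; left.
- by exists z => u [[[pu _]|uz] _]; [left|right].
- move=> u c Hu Bc; have uz := Hz _ Hu; split.
    by have := Zz.2 _ Bc => ?; ord lt_hom.
  move=> n; case: Hu => _ ->; have := smono _ _ uz; rewrite sz => ?.
  by have := y'B n c Bc => ?; ord lt_hom.
- by move=> /nsettled.
- by move=> /nsettled.
- move=> _; exists (z, w); split=> [|v Hv|n] /=.
  + by split=> /=; [right|rewrite sz].
  + have zv := Hz _ Hv; split=> //; case: Hv => _ ->; rewrite -sz; exact: smono.
    (* The answer [w'] to [z] in the region of [g n] is moved to [w] by an
       automorphism that fixes the common up_to_block end of these regions. *)
  + have [w' Ww' Ezw'] := equiv_split mu_uncountable lam_succ (ZW n) Zz.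
    have [r' [Wr' w'r']] := equiv_nonempty mu_uncountable lam_succ Ezw' (conj Zz' zz').
    have [r [rB w'r wr]] : exists r, [/\ forall b, B b -> lt r (g n b), lt w' r & lt w r].
      have r'B b : B b -> lt r' (g n b) by move=> Bb; apply: Wr'.2; exists b.
      have [lt_r'|nlt] := pselect (lt r' y').
        by exists y'; split=> [b|//|]; [apply: y'B|rewrite /= in w'r'; ord lt_hom|].
      by exists r'; split=> //; ord lt_hom.
    have [l lw lw'] := lt_lower_bound lt_hom w w'.
    have [q [qaut qw' qid]] := lt_bump lt_hom lw' lw w'r wr.
    have := equiv_aut lam_succ qaut (equivW Ezw').
    have -> : Z `&` [set x | lt z x] = between lt [set z] B.
      apply/seteqP; split=> [x [[_ xB] zx]|x [zx xB]]; first by split=> // _ ->.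
      have {}zx : lt z x by apply: zx.
      by split=> //; split=> // a' Aa'; apply: (lt_tr lt_hom (Zz.1 _ Aa') zx).
    have qb b : B b -> q (g n b) = g n b.
      by move=> /rB rb; apply: qid => -[_ ?]; ord lt_hom.
    suff -> : q @` (W n `&` [set y | lt w' y]) = between lt [set w] (g n @` B) by [].
    apply/seteqP; split=> [_ [x [[_ xB] w'x] <-]|x [wx xB]].
      split=> [_ ->|_ [b Bb <-]]; first by rewrite -qw' qaut.1.
      by rewrite -qb // qaut.1; apply: xB; exists b.
    have [x' qx'] := qaut.2 x; exists x' => //.
    have w'x' : lt w' x' by rewrite -qaut.1 qw' qx'; apply: wx.
    split=> //; split=> _ [c ? <-].
      by apply: (lt_tr lt_hom _ w'x'); apply: Ww'.1; exists c.
    by rewrite -qaut.1 qx' qb //; apply: xB; exists c.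
- move=> v Hv; exists s => // u [_ ->] //.
Qed.

Lemma half_exists p : C p -> exists H, half_block p H.
Proof.
by move=> Cp; have [/half_settled|/half_unsettled] := pselect (settled (up_to_block p)); apply.
Qed.

End HalfBlocks.

(** * Assembling the blocks *)

Section BlockEnds.
Variables mu lam : Type.
Hypothesis mu_uncountable : ~ countable [set: mu].
Hypothesis lam_succ : is_card_succ mu lam.
Variables (T : Type) (lt : T -> T -> Prop) (C : set T) (g : nat -> T -> T).
Hypothesis lt_hom : homogeneous lt.
Hypothesis g_replies : replies lam lt C g.
Local Notation good_cut := (good_cut lt C g).
Local Notation same_block := (same_block lt C g).
Local Notation up_to_block := (up_to_block lt C g).
Local Notation above_block := (above_block lt C g).
Local Notation settled := (settled lt g).
Local Notation equiv := (equiv lam).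
Local Notation dhalf_block := (half_block lam (dual_lt lt) C g).
Local Notation half_block := (half_block lam lt C g).
Implicit Types A B : set T.

Let mono := replies_mono g_replies.

Lemma equiv_between_dual n A B A' B' :
  equiv (dual_lt lt) n (between (dual_lt lt) A B) (between (dual_lt lt) A' B') ->
  equiv lt n (between lt B A) (between lt B' A').
Proof. by rewrite !(between_dual lt); apply: game_dual. Qed.

Section Ends.
Variables (P : set T) (H K : T -> set (T * T)).
Hypothesis halfH : forall p, P p -> half_block p (H p).
Hypothesis halfK : forall p, P p -> dhalf_block p (K p).
Hypothesis PC : P `<=` C.
Hypothesis P_cover : forall c, C c -> exists2 p, P p & same_block p c.
Hypothesis P_uniq : forall p q, P p -> P q -> same_block p q -> p = q.

Lemma block_below p u : P p -> H p u \/ K p u ->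
  exists2 u', H p u' & ~ lt u'.1 u.1 /\ ~ lt u'.2 u.2.
Proof.
move=> Pp [Hu|Ku]; first by exists u => //; split; apply: lt_irr.
exists (p, g 0 p); first exact: half_base (halfH Pp).
exact: (half_ge (halfK Pp) Ku).
Qed.

Lemma up_to_block_sub A B p : good_cut A B -> A p -> up_to_block p `<=` A.
Proof.
move=> gAB Ap c [Cc [q pq qc]]; have [_ _ e] := pq.
have Aq := (e _ _ gAB).1.1 Ap; have [//|Bc] := cut_mem gAB.1 Cc.
by have := gAB.1.2 _ _ Aq Bc.
Qed.

(** How the final map [G] looks just below the cut that a good cut [(A, B)]
    induces: either [A] is settled, and [G] approaches the cut exactly as all
    replies do, or [A] has a last block and [G] has a greatest pair below the
    cut, on which the game for the region above is won. *)
Lemma end_below A B (G : set (T * T)) : good_cut A B ->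
  (forall u, G u <-> exists p, [/\ P p, A p & H p u \/ K p u]) ->
  [/\ settled A, forall x, (forall w, G w -> lt w.1 x) <-> (forall a, A a -> lt a x) &
    forall n y, (forall w, G w -> lt w.2 y) <-> (forall a, A a -> lt (g n a) y)] \/
  (~ settled A /\ exists u,
    [/\ G u, forall w, G w -> ~ lt u.1 w.1 /\ ~ lt u.2 w.2 &
     forall n, equiv lt n (between lt [set u.1] B)
                          (between lt [set u.2] (g n @` B))]).
Proof.
move=> gAB GP; have cAB := gAB.1.
have AC a : A a -> C a by move=> Aa; apply/cAB.1; left.
have cover a : A a -> exists2 p, P p /\ A p & same_block p a.
  move=> Aa; have [p Pp pa] := P_cover (AC _ Aa); exists p => //; split=> //.
  by case: pa => _ _ e; apply/(e _ _ gAB).1.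
have last_or p : P p -> A p -> A = up_to_block p \/ exists2 c, A c & above_block p c.
  move=> Pp Ap; have [[c Ac pc]|none] := pselect (exists2 c, A c & above_block p c).
    by right; exists c.
  left; apply/seteqP; split; last exact: up_to_block_sub gAB Ap.
  move=> c Ac; have [//|pc] := cut_mem (up_to_block_cut C g lt_hom p) (AC _ Ac).
  by exfalso; apply: none; exists c.
have above p c : P p -> above_block p c ->
    exists2 p', P p' & above_block p p' /\ same_block p' c.
  move=> Pp pc; have Cc : C c by case: pc.
  have [p' Pp' p'c] := P_cover Cc; exists p' => //; split=> //.
  have [_ _ e] := p'c; have := e _ _ (up_to_block_good lt_hom g_replies (PC Pp)).
  by move=> [_ ->].
have [settledA|nsettledA] := pselect (settled A); [left; split=> //|right; split=> //].
- move=> x; split=> [Gx a Aa|Ax w /GP[p [Pp Ap pw]]].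
    have [p [Pp Ap] pa] := cover _ Aa; have [eA|[c Ac pc]] := last_or _ Pp Ap.
      have := half_cofinal (halfH Pp); rewrite -eA => /(_ settledA _ pa)[u Hu [ua _]].
      have : lt u.1 x by apply/Gx/GP; exists p; split=> //; left.
      by move=> ?; ord lt_hom.
    have [p' Pp' [pp' p'c]] := above _ _ Pp pc.
    have Ap' : A p' by case: p'c => _ _ e; apply/(e _ _ gAB).1.
    have : lt p' x.
      apply: (Gx (p', g 0 p')); apply/GP; exists p'; split=> //; left.
      exact: half_base (halfH Pp').
    have := pp'.2 _ pa => ? ?; ord lt_hom.
  have [u Hu [uw _]] := block_below Pp pw.
  have [eA|[c Ac pc]] := last_or _ Pp Ap.
    have := half_le (halfH Pp); rewrite -eA => /(_ settledA _ Hu)[q pq [uq _]].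
    have : lt q x by apply: Ax; rewrite eA; apply: same_block_upper.
    by move=> ?; ord lt_hom.
  have [uc _] := half_above (halfH Pp) Hu pc; have := Ax _ Ac => ?; ord lt_hom.
- move=> n y; split=> [Gy a Aa|Ay w /GP[p [Pp Ap pw]]].
    have [p [Pp Ap] pa] := cover _ Aa; have [eA|[c Ac pc]] := last_or _ Pp Ap.
      have [a' Aa' na'] := settledA n 0 a Aa.
      have [q pq qa'] : exists2 q, same_block p q & ~ lt q a' by move: Aa'; rewrite eA => -[].
      have := half_cofinal (halfH Pp); rewrite -eA => /(_ settledA _ pq)[u Hu [_ uq]].
      have : lt u.2 y by apply/Gy/GP; exists p; split=> //; left.
      have Cq : C q by case: pq.
      have := mono_le (n := 0) lt_hom mono (AC _ Aa') Cq qa' => ? ?; ord lt_hom.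
    have [p' Pp' [pp' p'c]] := above _ _ Pp pc.
    have Ap' : A p' by case: p'c => _ _ e; apply/(e _ _ gAB).1.
    have : lt (g 0 p') y.
      apply: (Gy (p', g 0 p')); apply/GP; exists p'; split=> //; left.
      exact: half_base (halfH Pp').
    have := good_cut_weak lt_hom mono n 0 (up_to_block_good lt_hom g_replies (PC Pp))
      (same_block_upper lt_hom pa) pp' => ? ?; ord lt_hom.
  have [u Hu [_ uw]] := block_below Pp pw.
  have [eA|[c Ac pc]] := last_or _ Pp Ap.
    have := half_le (halfH Pp); rewrite -eA => /(_ settledA _ Hu)[q pq [_ uq]].
    have Aq : A q by rewrite eA; apply: same_block_upper.
    have [a' Aa' na'] := settledA 0 n q Aq.
    by have := Ay _ Aa' => ?; ord lt_hom.
  have [_ /(_ n) uc] := half_above (halfH Pp) Hu pc; have := Ay _ Ac => ?; ord lt_hom.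
have [p [Pp Ap eA]] : exists p, [/\ P p, A p & A = up_to_block p].
  apply: contrapT => none; apply: nsettledA; apply: (settled_strict lt_hom mono).
  move=> a Aa; have [p [Pp Ap] pa] := cover _ Aa.
  have [eA|[c Ac pc]] := last_or _ Pp Ap; first by exfalso; apply: none; exists p.
  exists (up_to_block p), (above_block p), c.
  split=> //; first exact: (up_to_block_good lt_hom g_replies (PC Pp)).
  exact: same_block_upper.
have eB : above_block p = B := cut_rest lt_hom (up_to_block_cut C g lt_hom p) cAB (esym eA).
have := half_top (halfH Pp); rewrite -eA eB => /(_ nsettledA)[u [Hu utop uE]].
exists u; split=> //; first by apply/GP; exists p; split=> //; left.
move=> w /GP[q [Pq Aq qw]]; have [w' Hw' [ww1 ww2]] := block_below Pq qw.
have [pq|npq] := pselect (p = q).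
  by subst q; have [t1 t2] := utop _ Hw'; split; ord lt_hom.
have nsimqp : ~ same_block q p by move=> /(P_uniq Pq Pp) qp; apply: npq.
have qp : lt q p.
  have : up_to_block p q by rewrite -eA.
  move=> [_ [r pr rq]]; case: (lt_tot lt_hom q p) => [//|qp|pq].
    by exfalso; apply: npq.
  exfalso; case: (lt_tot lt_hom q r) => [qr|qr|//].
    by apply/nsimqp/same_block_sym/(same_block_convex lt_hom pr pq qr (PC Pq)).
  by apply/nsimqp/same_block_sym; rewrite qr.
have rqp := above_block_lt lt_hom (PC Pq) (PC Pp) qp nsimqp.
have [w'p /(_ 0) w'gp] := half_above (halfH Pq) Hw' rqp.
have [t1 t2] := half_ge (halfH Pp) Hu; split; ord lt_hom.
Qed.

End Ends.

(** A point with the same image under all replies is a block on its own, as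
    the cuts just below and just above it are good. *)
Lemma fixed_same_block c q : (forall n m, g n c = g m c) -> same_block c q -> ~ lt c q.
Proof.
move=> fix_c [Cc Cq e] cq.
pose A1 := [set x | C x /\ ~ lt c x]; pose B1 := [set x | C x /\ lt c x].
have gAB : good_cut A1 B1.
  split.
    split=> [x|a b [_ ca] [_ cb]]; last by ord lt_hom.
    split=> [Cx|[][]//]; have [cx|cx] := pselect (lt c x); [by right|by left].
  left=> n m a [Ca ca]; exists c; first by split=> //; apply: lt_irr.
  by rewrite (fix_c m n); apply: (mono_le lt_hom mono).
by have [] := (e _ _ gAB).1.1 (conj Cc (@lt_irr _ _ lt_hom c)).
Qed.

End BlockEnds.

Section Assembly.
Variables mu lam : Type.
Hypothesis mu_uncountable : ~ countable [set: mu].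
Hypothesis lam_succ : is_card_succ mu lam.
Variables (T : Type) (lt : T -> T -> Prop) (C : set T) (g : nat -> T -> T).
Hypothesis lt_hom : homogeneous lt.
Hypothesis g_replies : replies lam lt C g.
Local Notation small A := (card_lt A [set: lam]).
Local Notation cut := (cut lt C).
Local Notation dgood := (good_cut (dual_lt lt) C g).
Local Notation good_cut := (good_cut lt C g).
Local Notation dsame_block := (same_block (dual_lt lt) C g).
Local Notation same_block := (same_block lt C g).
Local Notation dup_to_block := (up_to_block (dual_lt lt) C g).
Local Notation up_to_block := (up_to_block lt C g).
Local Notation dabove_block := (above_block (dual_lt lt) C g).
Local Notation above_block := (above_block lt C g).
Local Notation dsettled := (settled (dual_lt lt) g).
Local Notation settled := (settled lt g).
Local Notation equiv := (equiv lam).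
Local Notation dhalf_block := (half_block lam (dual_lt lt) C g).
Local Notation half_block := (half_block lam lt C g).
Implicit Types A B : set T.

Let mono := replies_mono g_replies.
Let dual_hom := homogeneous_dual lt_hom.
Let g_dual := replies_dual g_replies.

Variables (P : set T) (H K : T -> set (T * T)).
Hypothesis halfH : forall p, P p -> half_block p (H p).
Hypothesis halfK : forall p, P p -> dhalf_block p (K p).
Hypothesis PC : P `<=` C.
Hypothesis P_cover : forall c, C c -> exists2 p, P p & same_block p c.
Hypothesis P_uniq : forall p q, P p -> P q -> same_block p q -> p = q.

Let block p := H p `|` K p.

(** If the two blocks are adjacent then the good cut between them is settled on
    one side, where the map is interleaved with [g 0]; otherwise some point of
    [C] lies between them, and its images separate the values. *)
Lemma block_order p q u v : P p -> P q -> lt p q -> block p u -> block q v ->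
  lt u.1 v.1 /\ lt u.2 v.2.
Proof.
move=> Pp Pq pq pu qv; have npq : ~ same_block p q.
  by move=> /(P_uniq Pp Pq) e; rewrite e in pq; have := lt_irr lt_hom pq.
have [u' Hu [uu1 uu2]] := block_below lt_hom halfH halfK Pp pu.
have [v' Kv [vv1 vv2]] : exists2 v', K q v' & ~ dual_lt lt v'.1 v.1 /\ ~ dual_lt lt v'.2 v.2.
  apply: (block_below dual_hom halfK halfH) => //.
  by case: qv; [right|left].
rewrite /dual_lt in vv1 vv2; suff [? ?] : lt u'.1 v'.1 /\ lt u'.2 v'.2 by split; ord lt_hom.
have [Cp Cq] := (PC Pp, PC Pq).
have gp := up_to_block_good lt_hom g_replies Cp.
have gq := up_to_block_good dual_hom g_dual Cq.
have [sp|nsp] := pselect (settled (up_to_block p)).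
  have [r pr [ru1 ru2]] := half_le (halfH Pp) sp Hu.
  have rr : dabove_block q r.
    split=> [|q' /same_block_dual qq']; first by case: pr.
    exact: (same_block_lt lt_hom pr qq' pq npq).
  have [rv1 /(_ 0) rv2] := half_above (halfK Pq) Kv rr; rewrite /dual_lt in rv1 rv2.
  by split; ord lt_hom.
have sp' : dsettled (above_block p) by case: gp => _ [].
have [sq|nsq] := pselect (dsettled (dup_to_block q)).
  have [r /same_block_dual qr [ru1 ru2]] := half_le (halfK Pq) sq Kv; rewrite /dual_lt in ru1 ru2.
  have rr : above_block p r.
    split=> [|p' pp']; first by case: qr.
    exact: (same_block_lt lt_hom pp' qr pq npq).
  have [rv1 /(_ 0) rv2] := half_above (halfH Pp) Hu rr.
  by split; ord lt_hom.
have [c pc qc] : exists2 c, above_block p c & dabove_block q c.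
  apply: contrapT => none; apply: nsq.
  suff -> : dup_to_block q = above_block p by [].
  apply/seteqP; split=> c.
    move=> [Cc [r /same_block_dual qr rc]]; split=> // p' pp'.
    by have := same_block_lt lt_hom pp' qr pq npq => ?; rewrite /dual_lt in rc; ord lt_hom.
  move=> pc; have Cc : C c by case: pc.
  have [//|qc] := cut_mem (up_to_block_cut C g dual_hom q) Cc.
  by exfalso; apply: none; exists c.
have [uc1 /(_ 0) uc2] := half_above (halfH Pp) Hu pc.
have [vc1 /(_ 0) vc2] := half_above (halfK Pq) Kv qc; rewrite /dual_lt in vc1 vc2.
by split; ord lt_hom.
Qed.

Lemma block_aut p u v : P p -> block p u -> block p v -> exists2 s, aut lt s &
  forall w, block p w -> ~ lt w.1 u.1 -> ~ lt v.1 w.1 -> w.2 = s w.1.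
Proof.
move=> Pp pu pv.
have [v' Hv [vv _]] := block_below lt_hom halfH halfK Pp pv.
have [u' Ku [uu _]] : exists2 u', K p u' & ~ dual_lt lt u'.1 u.1 /\ ~ dual_lt lt u'.2 u.2.
  apply: (block_below dual_hom halfK halfH) => //.
  by case: pu; [right|left].
rewrite /dual_lt in uu.
have [s saut sP] := half_aut (halfH Pp) Hv.
have [t [rtmono tsurj] tP] := half_aut (halfK Pp) Ku; rewrite /dual_lt in tP.
have taut : aut lt t by split=> // x y; apply: rtmono.
have ep : t p = s p.
  rewrite -(sP _ (half_base (halfH Pp))) ?(tP _ (half_base (halfK Pp))) //=.
    by have [] := half_ge (halfK Pp) Ku.
  by have [] := half_ge (halfH Pp) Hv.
have [r [raut rt rs]] := aut_glue lt_hom taut saut ep.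
exists r => // w [Hw|Kw] wu vw.
  rewrite rs; last by have [] := half_ge (halfH Pp) Hw.
  by apply: sP => // ?; ord lt_hom.
rewrite rt; last by have [] := half_ge (halfK Pp) Kw.
by apply: tP => // ?; ord lt_hom.
Qed.

Definition assembled : set (T * T) := [set u | exists2 p, P p & block p u].
Local Notation G := assembled.

Lemma block_mem p u : P p -> block p u -> G u.
Proof. by exists p. Qed.

Lemma assembled_ordpres : ordpres lt G.
Proof.
have lts p u v : P p -> block p u -> block p v -> lt u.1 v.1 -> lt u.2 v.2.
  move=> Pp pu pv uv; have [s saut sP] := block_aut Pp pu pv.
  rewrite (sP u) ?(sP v) ?saut.1 //; try exact: lt_irr; exact: lt_le.
apply: ordpres_strict => // u v [p Pp pu] [q Pq qv].
  case: (lt_tot lt_hom p q) => [pq|pq|qp] uv.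
  - by have [] := block_order Pp Pq pq pu qv.
  - by subst q; apply: lts pu qv uv.
  - by have [? _] := block_order Pq Pp qp qv pu; ord lt_hom.
move=> uv; case: (lt_tot lt_hom p q) => [pq|pq|qp].
- by have [+ _] := block_order Pp Pq pq pu qv; rewrite uv => /(lt_irr lt_hom).
- subst q; have [s saut sP] := block_aut Pp pu qv.
  by rewrite (sP u) ?(sP v) ?uv //; apply: lt_irr.
- by have [+ _] := block_order Pq Pp qp qv pu; rewrite uv => /(lt_irr lt_hom).
Qed.

Lemma between_cofinal (X Y X' Y' : set T) : X `<=` X' -> Y `<=` Y' ->
  (forall x, X' x -> exists2 a, X a & ~ lt a x) ->
  (forall x, Y' x -> exists2 b, Y b & ~ lt x b) ->
  between lt X Y = between lt X' Y'.
Proof.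
move=> XX' YY' cX cY; rewrite -(@between_refine _ _ lt_hom X Y X' Y' X Y) ?setIid //.
  by move=> x /cX; right.
by move=> x /cY; right.
Qed.

(** Around a cut that falls inside a block, the map agrees with an automorphism,
    which matches the two regions. *)
Lemma assembled_cut_inside n (A B : set (T * T)) p u v : pcut lt G A B -> P p ->
  block p u -> A u -> block p v -> B v ->
  equiv lt n (between lt (fst @` A) (fst @` B)) (between lt (snd @` A) (snd @` B)).
Proof.
move=> cAB Pp pu Au pv Bv; have [s saut sP] := block_aut Pp pu pv.
have Go := assembled_ordpres.
have AG w : A w -> G w by move=> ?; apply/cAB.1; left.
have BG w : B w -> G w by move=> ?; apply/cAB.1; right.
have inblock w : G w -> ~ lt w.1 u.1 -> ~ lt v.1 w.1 -> block p w.
  move=> [q Pq qw] wu vw; case: (lt_tot lt_hom p q) => [pq|pq|qp].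
  - by have [] := block_order Pp Pq pq pv qw.
  - by subst q.
  - by have [] := block_order Pq Pp qp qw pu.
pose A1 := A `&` [set w | ~ lt w.1 u.1]; pose B1 := B `&` [set w | ~ lt v.1 w.1].
have A1s w : A1 w -> w.2 = s w.1.
  move=> [Aw wu]; have vw : ~ lt v.1 w.1 := lt_le lt_hom (cAB.2 _ _ Aw Bv).
  exact: sP (inblock _ (AG _ Aw) wu vw) wu vw.
have B1s w : B1 w -> w.2 = s w.1.
  move=> [Bw vw]; have wu : ~ lt w.1 u.1 := lt_le lt_hom (cAB.2 _ _ Au Bw).
  exact: sP (inblock _ (BG _ Bw) wu vw) wu vw.
have Acof w : A w -> exists2 a, A1 a & ~ lt a.1 w.1.
  move=> Aw; have [wu|wu] := pselect (lt w.1 u.1).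
    by exists u; [split=> //=; apply: lt_irr|apply: lt_le].
  by exists w => //; apply: lt_irr.
have Bcof w : B w -> exists2 b, B1 b & ~ lt w.1 b.1.
  move=> Bw; have [vw|vw] := pselect (lt v.1 w.1).
    by exists v; [split=> //=; apply: lt_irr|apply: lt_le].
  by exists w => //; apply: lt_irr.
have -> : between lt (fst @` A) (fst @` B) = between lt (fst @` A1) (fst @` B1).
  apply/esym/between_cofinal; try by apply: image_subset; apply: subIsetl.
    by move=> _ [w /Acof[a A1a aw] <-]; exists a.1 => //; exists a.
  by move=> _ [w /Bcof[b B1b bw] <-]; exists b.1 => //; exists b.
have -> : between lt (snd @` A) (snd @` B) = between lt (snd @` A1) (snd @` B1).
  apply/esym/between_cofinal; try by apply: image_subset; apply: subIsetl.
    move=> _ [w Aw <-]; have [a A1a aw] := Acof _ Aw; exists a.2; first by exists a.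
    by rewrite -(Go _ _ (AG _ A1a.1) (AG _ Aw)).
  move=> _ [w Bw <-]; have [b B1b bw] := Bcof _ Bw; exists b.2; first by exists b.
  by rewrite -(Go _ _ (BG _ Bw) (BG _ B1b.1)).
have img (X : set (T * T)) : (forall w, X w -> w.2 = s w.1) -> snd @` X = s @` (fst @` X).
  move=> XP; apply/seteqP; split=> [_ [w Xw <-]|_ [_ [w Xw <-] <-]].
    by exists w.1; [exists w|rewrite XP].
  by exists w => //; rewrite XP.
rewrite (img _ A1s) (img _ B1s) aut_between //.
exact: (equiv_aut_image mu_uncountable lam_succ).
Qed.

Lemma between_ext (X Y X' Y' : set T) :
  (forall x, (forall a, X a -> lt a x) <-> (forall a, X' a -> lt a x)) ->
  (forall x, (forall b, Y b -> lt x b) <-> (forall b, Y' b -> lt x b)) ->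
  between lt X Y = between lt X' Y'.
Proof. by move=> eX eY; apply/seteqP; split=> x [/eX ? /eY ?]. Qed.

Lemma all_image (X : Type) (f : X -> T) (A : set X) (Q : T -> Prop) :
  (forall y, (f @` A) y -> Q y) <-> (forall x, A x -> Q (f x)).
Proof. by split=> [h x Ax|h _ [x Ax <-]]; apply: h => //; exists x. Qed.

(** A cut that respects the blocks is a good cut of [C]. If it is settled on
    both sides, its regions are those of all replies; if it is settled on one
    side only, the other side ends with an extra pair that was chosen so as to
    win the game; and a good cut is settled on some side. *)
Lemma assembled_cuts n : cuts_equiv lam lt n G.
Proof.
move=> A B cAB.
have [[p [u [v [Pp [pu Au] [pv Bv]]]]]|noblock] := pselect (exists p u v,
    [/\ P p, block p u /\ A u & block p v /\ B v]).
  exact: assembled_cut_inside cAB Pp pu Au pv Bv.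
have AG w : A w -> G w by move=> ?; apply/cAB.1; left.
have BG w : B w -> G w by move=> ?; apply/cAB.1; right.
have base p : P p -> block p (p, g 0 p) by move=> Pp; left; apply: half_base (halfH Pp).
pose A0 := [set c | C c /\ exists2 p, P p /\ same_block p c & A (p, g 0 p)].
pose B0 := [set c | C c /\ exists2 p, P p /\ same_block p c & B (p, g 0 p)].
have c0 : cut A0 B0.
  split=> [c|a b [Ca [p [Pp pa] Ap]] [Cb [q [Pq qb] Bq]]].
    split=> [Cc|[][]//]; have [p Pp pc] := P_cover Cc.
    by have /cAB.1[?|?] := block_mem Pp (base _ Pp); [left|right]; split=> //; exists p.
  have pq : lt p q := cAB.2 _ _ Ap Bq.
  apply: (same_block_lt lt_hom pa qb pq) => /(P_uniq Pp Pq) e.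
  by rewrite e in pq; have := lt_irr lt_hom pq.
have rep p : P p -> A0 p -> A (p, g 0 p).
  by move=> Pp [_ [q [Pq qp] Aq]]; rewrite -(P_uniq Pq Pp qp).
have rep' p : P p -> B0 p -> B (p, g 0 p).
  by move=> Pp [_ [q [Pq qp] Bq]]; rewrite -(P_uniq Pq Pp qp).
have g0 : good_cut A0 B0.
  apply: (good_cut_union lt_hom mono c0) => a A0a; have Ca : C a by case: A0a.
  exists (up_to_block a), (above_block a).
  split; [exact: (up_to_block_good lt_hom g_replies)|exact: up_to_block_self|].
  move=> c [Cc [q aq qc]]; have [//|B0c] := cut_mem c0 Cc.
  have A0q : A0 q.
    split; first by case: aq.
    have [_ [p [Pp pa] Ap]] := A0a; exists p => //; split=> //.
    exact: same_block_trans pa aq.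
  by have := c0.2 _ _ A0q B0c.
have AP u : A u <-> exists p, [/\ P p, A0 p & H p u \/ K p u].
  split=> [Au|[p [Pp A0p pu]]].
    have [p Pp pu] := AG _ Au; exists p; split=> //; split; first exact: PC.
    exists p; first by split=> //; exact/same_block_refl/PC.
    have /cAB.1[//|Bp] := block_mem Pp (base _ Pp).
    by exfalso; apply: noblock; exists p, u, (p, g 0 p); split=> //; split=> //; apply: base.
  have /cAB.1[//|Bu] := block_mem Pp pu.
  exfalso; apply: noblock; exists p, (p, g 0 p), u; split=> //.
  by split; [apply: base|apply: rep].
have BP u : B u <-> exists p, [/\ P p, B0 p & K p u \/ H p u].
  split=> [Bu|[p [Pp B0p pu]]].
    have [p Pp pu] := BG _ Bu; exists p; split=> //; last by case: pu; [right|left].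
    split; first exact: PC.
    exists p; first by split=> //; exact/same_block_refl/PC.
    have /cAB.1[Ap|//] := block_mem Pp (base _ Pp).
    by exfalso; apply: noblock; exists p, (p, g 0 p), u; split=> //; split=> //; apply: base.
  have {}pu : block p u by case: pu; [right|left].
  have /cAB.1[Au|//] := block_mem Pp pu.
  exfalso; apply: noblock; exists p, u, (p, g 0 p); split=> //.
  by split; [apply: base|apply: rep'].
have below := end_below lt_hom g_replies halfH halfK PC P_cover P_uniq g0 AP.
have rcover c : C c -> exists2 p, P p & dsame_block p c.
  by move=> /P_cover[p Pp /same_block_dual]; exists p.
have runiq p q : P p -> P q -> dsame_block p q -> p = q.
  by move=> Pp Pq /same_block_dual; apply: P_uniq.
have rg0 : dgood B0 A0 by apply/good_cut_dual.
have above := end_below dual_hom g_dual halfK halfH PC rcover runiq rg0 BP.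
case: below => [[sA A1 A2]|[nsA [u [Au utop uE]]]];
  case: above => [[sB B1 B2]|[nsB [v [Bv vtop vE]]]].
- have -> : between lt (fst @` A) (fst @` B) = between lt A0 B0.
    by apply: between_ext => x; rewrite all_image; [apply: A1|apply: B1].
  have -> : between lt (snd @` A) (snd @` B) = between lt (g n @` A0) (g n @` B0).
    by apply: between_ext => x; rewrite !all_image; [apply: A2|apply: B2].
  exact/equivW/equivW/(replies_cut g_replies).
- have := equiv_between_dual (vE n).
  have -> : between lt (fst @` A) (fst @` B) = between lt A0 [set v.1].
    apply: between_ext => x; rewrite all_image; first exact: A1.
    split=> [h _ ->|h w /vtop[vw _]]; first exact: h.
    by have := h _ erefl => ?; rewrite /dual_lt in vw; ord lt_hom.
  suff -> : between lt (snd @` A) (snd @` B) = between lt (g n @` A0) [set v.2] by [].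
  apply: between_ext => x; rewrite !all_image; first exact: A2.
  split=> [h _ ->|h w /vtop[_ vw]]; first exact: h.
  by have := h _ erefl => ?; rewrite /dual_lt in vw; ord lt_hom.
- have := uE n.
  have -> : between lt (fst @` A) (fst @` B) = between lt [set u.1] B0.
    apply: between_ext => x; rewrite all_image; last exact: B1.
    split=> [h _ ->|h w /utop[uw _]]; first exact: h.
    by have := h _ erefl => ?; ord lt_hom.
  suff -> : between lt (snd @` A) (snd @` B) = between lt [set u.2] (g n @` B0) by [].
  apply: between_ext => x; rewrite !all_image; last exact: B2.
  split=> [h _ ->|h w /utop[_ uw]]; first exact: h.
  by have := h _ erefl => ?; ord lt_hom.
- by case: g0 => _ [].
Qed.

(** Besides the points of [C], each block contributes at most two points. *)
Lemma assembled_small : small C -> small G.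
Proof.
move=> sC.
have /choice[z zP] p : exists z, P p -> forall u, H p u -> same_block p u.1 \/ u.1 = z.
  have [Pp|nPp] := pselect (P p); last by exists p.
  by have [z zP] := half_small (halfH Pp); exists z.
have /choice[z' zP'] p : exists z, P p -> forall u, K p u -> same_block p u.1 \/ u.1 = z.
  have [Pp|nPp] := pselect (P p); last by exists p.
  have [z' zP'] := half_small (halfK Pp); exists z' => _ u /zP'[/same_block_dual|]; by [left|right].
pose S := C `|` (z @` C `|` z' @` C).
have sS : small S.
  by do 2![apply: (smallU mu_uncountable lam_succ) => //];
    apply: (small_image lam_succ).
have /choice[f fP] x : exists y, (exists y, G (x, y)) -> G (x, y).
  have [[y Gy]|none] := pselect (exists y, G (x, y)); first by exists y.
  by exists x => /none.
apply: (small_sub lam_succ) (small_image lam_succ (fun x => (x, f x)) sS) _.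
move=> [x y] Gxy; exists x; last first.
  by congr pair; apply: (ordpres_func lt_hom assembled_ordpres (fP x _)) => //; exists y.
have [p Pp [Hu|Ku]] := Gxy.
  have [[_ Cx _]|/= ->] := zP _ Pp _ Hu; first by left.
  by right; left; exists p => //; apply: PC.
have [[_ Cx _]|/= ->] := zP' _ Pp _ Ku; first by left.
by right; right; exists p => //; apply: PC.
Qed.

Lemma assembled_dom c : C c -> exists y, G (c, y).
Proof.
move=> Cc; have [p Pp pc] := P_cover Cc; have [cp|cp] := pselect (lt c p).
  have [||y Ky] := half_dom (halfK Pp) (q := c); first exact/same_block_dual.
    by rewrite /dual_lt; apply: lt_le.
  by exists y, p => //; right.
by have [y Hy] := half_dom (halfH Pp) pc cp; exists y, p => //; left.
Qed.

Lemma assembled_fixed c : C c -> (forall n m, g n c = g m c) -> G (c, g 0 c).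
Proof.
move=> Cc fix_c; have [p Pp pc] := P_cover Cc.
have cp := same_block_sym pc.
have n1 := fixed_same_block lt_hom g_replies fix_c cp.
have n2 := fixed_same_block dual_hom g_dual fix_c ((same_block_dual lt C g c p).2 cp).
have -> : c = p by rewrite /dual_lt in n2; ord lt_hom.
by exists p => //; left; apply: half_base (halfH Pp).
Qed.

End Assembly.

(** * One reply for all finite ranks *)

Section Step.
Variables mu lam : Type.
Hypothesis mu_uncountable : ~ countable [set: mu].
Hypothesis lam_succ : is_card_succ mu lam.
Variables (T : Type) (lt : T -> T -> Prop).
Hypothesis lt_hom : homogeneous lt.
Local Notation small A := (card_lt A [set: lam]).
Local Notation game := (game lam lt).

Lemma merge_replies (C : set T) (g : nat -> T -> T) : small C ->
  replies lam lt C g -> exists G, [/\ forall c, C c -> exists y, G (c, y),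
    forall c, C c -> (forall n m, g n c = g m c) -> G (c, g 0 c) &
    forall n, game n setT setT G].
Proof.
move=> sC g_replies.
have /choice[r0 r0P] (S : set T) : exists o : option T, forall c, S c ->
    exists2 x, o = Some x & S x.
  have [[x Sx]|nS] := pselect (exists x, S x); first by exists (Some x) => _ _; exists x.
  by exists None => c Sc; exfalso; apply: nS; exists c.
pose r c := odflt c (r0 (same_block lt C g c)).
have rS c : C c -> same_block lt C g c (r c).
  by move=> Cc; have [x r0x cx] := r0P _ _ (same_block_refl lt g Cc); rewrite /r r0x.
have rE c d : same_block lt C g c d -> r c = r d.
  move=> cd; have eS : same_block lt C g c = same_block lt C g d.
    by apply/seteqP; split=> x; apply: same_block_trans => //; apply: same_block_sym.
  by have [x r0x _] := r0P _ _ cd; rewrite /r -eS r0x.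
pose P := [set p | C p /\ r p = p].
have PC : P `<=` C by move=> p [].
have P_cover c : C c -> exists2 p, P p & same_block lt C g p c.
  move=> Cc; have cr := rS _ Cc; exists (r c); last exact: same_block_sym.
  by split; [case: cr|rewrite -(rE _ _ cr)].
have P_uniq p q : P p -> P q -> same_block lt C g p q -> p = q.
  by move=> [_ rp] [_ rq] /rE; rewrite rp rq.
have /choice[H halfH] p : exists H, P p -> half_block lam lt C g p H.
  have [[Cp _]|nPp] := pselect (P p); last by exists set0.
  by have [H] := half_exists mu_uncountable lam_succ lt_hom g_replies Cp; exists H.
have /choice[K halfK] p : exists K, P p -> half_block lam (dual_lt lt) C g p K.
  have [[Cp _]|nPp] := pselect (P p); last by exists set0.
  have [K] := half_exists mu_uncountable lam_succ (homogeneous_dual lt_hom)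
    (replies_dual g_replies) Cp; by exists K.
exists (assembled P H K); split.
- move=> c; exact: (assembled_dom lt_hom halfH halfK P_cover).
- by move=> c; exact: (assembled_fixed lt_hom g_replies K halfH P_cover).
- move=> n; apply: (game_cuts mu_uncountable lam_succ lt_hom).
  + exact: (assembled_ordpres lt_hom g_replies halfH halfK PC P_uniq).
  + exact: (assembled_small mu_uncountable lam_succ lt_hom g_replies halfH halfK PC P_uniq sC).
  + exact: (assembled_cuts mu_uncountable lam_succ lt_hom g_replies halfH halfK PC P_cover P_uniq n).
Qed.

(** The replies to [D] of the various finite ranks are merged into a single
    one, which still extends [G] because all of them fix the images of the
    points of [G]. *)
Lemma omega_forth (G : set (T * T)) (D : set T) : (forall n, game n setT setT G) ->
  small D -> exists G', [/\ G `<=` G', D `<=` fst @` G' & forall n, game n setT setT G'].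
Proof.
move=> rG sD; have [Go Gs _] := game_base (rG 0).
pose C := D `|` fst @` G.
have sC : small C.
  by apply: (smallU mu_uncountable lam_succ) => //; apply: (small_image lam_succ).
have /choice[F FP] n : exists G', [/\ G `<=` G', C `<=` fst @` G' & game n.+2 setT setT G'].
  by have [_ [f _]] := rG n.+3; apply: f.
have /choice[g gP] n : exists g, forall c, C c -> F n (c, g c).
  have /choice[g gP] c : exists y, C c -> F n (c, y).
    have [Cc|nCc] := pselect (C c); last by exists c.
    by have [_ /(_ c Cc)[[c' y] Fy /= <-] _] := FP n; exists y.
  by exists g.
have Fo n : ordpres lt (F n) by have [_ _ /game_base[]] := FP n.
have g_replies : replies lam lt C g.
  split=> [n x y Cx Cy|n A B [CAB _]].
    by move/(Fo n (x, g n x) (y, g n y)); apply; apply: gP.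
  have [_ _ rF] := FP n; pose gr := fun c : T => (c, g n c).
  have sub X : X `<=` C -> gr @` X `<=` F n by move=> XC _ [c /XC Cc <-]; apply: gP.
  have e1 X : fst @` (gr @` X) = X.
    by apply/seteqP; split=> [_ [_ [c Xc <-] <-]|c Xc] //; exists (gr c) => //; exists c.
  have e2 X : snd @` (gr @` X) = g n @` X.
    apply/seteqP; split=> [_ [_ [c Xc <-] <-]|_ [c Xc <-]]; first by exists c.
    by exists (gr c) => //; exists c.
  have := game_between lam_succ rF (A := gr @` A) (B := gr @` B).
  rewrite !setTI !e1 !e2; apply; apply: sub => c ?; apply/CAB; [by left|by right].
have [G' [G'dom G'fix rG']] := merge_replies sC g_replies.
exists G'; split=> // [[x y] Gxy|x Dx].
  have gx n : g n x = y.
    apply: (ordpres_func lt_hom (Fo n)); first by apply: gP; right; exists (x, y).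
    by have [GF _ _] := FP n; apply: GF.
  rewrite -(gx 0); apply: G'fix => [|n m]; first by right; exists (x, y).
  by rewrite !gx.
by have [|y G'y] := G'dom x; [left|exists (x, y)].
Qed.

Lemma omega_back (G : set (T * T)) (D : set T) : (forall n, game n setT setT G) ->
  small D -> exists G', [/\ G `<=` G', D `<=` snd @` G' & forall n, game n setT setT G'].
Proof.
move=> rG sD; have [|G' [GG' DG' rG']] := omega_forth (G := converse G) _ sD.
  by move=> n; apply: (game_converse lam_succ).
exists (converse G'); split=> [[x y] /(GG' (y, x))//||n].
  by rewrite converse_image.
exact: (game_converse lam_succ).
Qed.

End Step.

(** * Ordinals up to omega *)

Section WellOrder.
Variable a : Ord.
Implicit Types x y z : osort a.

Lemma oleq_min (A : set (osort a)) : A !=set0 ->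
  exists2 x, A x & forall y, A y -> oleq x y.
Proof.
move=> [x Ax]; have [|z [[/asboolP Az zmin] _]] := @oleq_wo a [pred x | `[< A x >]].
  by exists x; apply/asboolP.
by exists z => // y Ay; apply: zmin; apply/asboolP.
Qed.

Lemma oleq_total x y : oleq x y \/ oleq y x.
Proof.
have [|z [->|->] zmin] := @oleq_min [set x; y]; first by exists x; left.
  by left; apply: zmin; right.
by right; apply: zmin; left.
Qed.

Lemma oleqxx x : oleq x x.
Proof. by case: (oleq_total x x). Qed.

Lemma oleq_anti x y : oleq x y -> oleq y x -> x = y.
Proof.
move=> xy yx; have [|z [_ zuniq]] := @oleq_wo a
    [pred t | (t == x :> {classic osort a}) || (t == y :> {classic osort a})].
  by exists x; rewrite inE /= eqxx.
rewrite -(zuniq x) ?(zuniq y) //; split.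
- by rewrite inE /= eqxx orbT.
- by move=> t; rewrite inE /= => /orP[] /eqP ->; [|apply: oleqxx].
- by rewrite inE /= eqxx.
- by move=> t; rewrite inE /= => /orP[] /eqP ->; [apply: oleqxx|].
Qed.

Lemma oleq_trans x y z : oleq x y -> oleq y z -> oleq x z.
Proof.
move=> xy yz; have [|t tA tmin] := @oleq_min [set x; y; z]; first by exists x; left; left.
have tx : oleq t x by apply: tmin; left; left.
have ty : oleq t y by apply: tmin; left; right.
have tz : oleq t z by apply: tmin; right.
move: tx ty tz; case: tA => [[->|->]|->] // tx ty tz.
  by rewrite -(oleq_anti tx xy).
by rewrite (oleq_anti yz ty) in xy.
Qed.

Lemma oleqN x y : ~ oleq x y -> oleq y x.
Proof. by case: (oleq_total x y). Qed.
End WellOrder.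

Lemma oeq_refl a : oeq a a.
Proof. by exists id => //; exists id. Qed.

Lemma oeq_sym a b : oeq a b -> oeq b a.
Proof.
move=> [f [f' fK f'K] fmono]; exists f'; first by exists f.
by move=> x y; rewrite -fmono !f'K.
Qed.

Lemma oeq_trans b a c : oeq a b -> oeq b c -> oeq a c.
Proof.
move=> [f fbij fmono] [h hbij hmono]; exists (h \o f); first exact: bij_comp.
by move=> x y /=; rewrite hmono.
Qed.

Lemma oeq_ole a b : oeq a b -> ole a b.
Proof. by move=> [f [f' fK f'K] fmono]; exists f; split=> // x z _; exists (f' z). Qed.

Lemma ole_trans b a c : ole a b -> ole b c -> ole a c.
Proof.
move=> [f [fmono finit]] [h [hmono hinit]]; exists (h \o f); split=> [x y|x z].
  by rewrite /= hmono.
by move=> /[dup] /hinit[y <-]; rewrite hmono => /finit[t <-]; exists t.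
Qed.

Lemma oeq_osucc a b : oeq a b -> oeq (osucc a) (osucc b).
Proof.
move=> [f [f' fK f'K] fmono]; exists (omap f); last by move=> [x|] [y|] //=.
by exists (omap f') => [] [x|] //=; rewrite ?fK ?f'K.
Qed.

Lemma oeq_osuccI a b : oeq (osucc a) (osucc b) -> oeq a b.
Proof.
move=> [f [f' fK f'K] fmono].
have fN : f None = None.
  by have := fmono (f' None) None; rewrite f'K /=; case: (f' None) (f None) => [x|] [y|].
have f'N : f' None = None by rewrite -fN fK.
have fS x : exists y, f (Some x) = Some y.
  case fx : (f (Some x)) => [y|]; first by exists y.
  by move: (fK (Some x)); rewrite fx f'N.
have f'S x : exists y, f' (Some x) = Some y.
  case fx : (f' (Some x)) => [y|]; first by exists y.
  by move: (f'K (Some x)); rewrite fx fN.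
have /choice[h hP] := fS; have /choice[h' h'P] := f'S.
exists h; last by move=> x y; have := fmono (Some x) (Some y); rewrite !hP.
exists h' => x; apply: Some_inj; first by rewrite -h'P -hP fK.
by rewrite -hP -h'P f'K.
Qed.

Lemma osucc_neq0 a : ~ oeq (osucc a) ozero.
Proof. by move=> [f _ _]; case: (f None). Qed.

Lemma ofin_wo n : wochoice.well_order (fun i j : 'I_n => i <= j).
Proof.
apply: wochoice.antisymmetric_well_order.
  by move=> i j /anti_leq/val_inj.
move=> A [i Ai]; exists [arg min_(j < i | j \in A) val j].
by case: arg_minnP => // j Aj jmin; split.
Qed.

Definition ofin n : Ord := MkOrd (@ofin_wo n).

Lemma ofin0 : oeq (ofin 0) ozero.
Proof.
exists (fun i : 'I_0 => match notF (ltn_ord i) with end); last by case.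
by exists (fun v : void => match v with end) => -[].
Qed.

Lemma ofinS n : oeq (ofin n.+1) (osucc (ofin n)).
Proof.
apply: oeq_sym; exists (fun o : option 'I_n =>
  if o is Some i then widen_ord (leqnSn n) i else ord_max).
  exists (fun i : 'I_n.+1 => insub (val i)) => [[i|]|i] /=.
  - by rewrite insubT //= => lt_in; congr Some; apply: val_inj.
  - by rewrite insubF // ltnn.
  - case: insubP => [j jn ij|]; first exact/val_inj.
    by rewrite -leqNgt => ni; apply/val_inj/anti_leq; rewrite /= ni -ltnS ltn_ord.
move=> [i|] [j|] //=; last 1 first.
- by rewrite leqnn.
- by apply/ltnW.
- by rewrite leqNgt ltn_ord.
Qed.

Lemma ole_ofin m n : m <= n -> ole (ofin m) (ofin n).
Proof.
move=> mn; exists (widen_ord mn); split=> // i j ji.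
have jm : (j : 'I_n) < m := leq_ltn_trans ji (ltn_ord i).
by exists (Ordinal jm); apply: val_inj.
Qed.

Lemma ole_ofin_omega n : ole (ofin n) omega.
Proof.
exists val; split=> // i k /= ki; have kn : (k : nat) < n := leq_ltn_trans ki (ltn_ord i).
by exists (Ordinal kn).
Qed.

Lemma omega_neq_ofin n : ~ oeq (ofin n) omega.
Proof.
move=> [f [f' fK f'K] fmono].
have /leq_card : injective (fun i : 'I_n.+1 => f' (val i)).
  by move=> i j /(can_inj f'K)/val_inj.
by rewrite !card_ord ltnn.
Qed.

Lemma olimit_omega : olimit omega.
Proof.
split=> [[f _ _]|[b [f [f' fK f'K] fmono]]]; first by case: (f 0).
have := fmono (f' None).+1 (f' None); rewrite f'K /= ltnn.
by case: (f _).
Qed.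

(** An ordinal in which one can climb [omega] steps contains [omega]; if the
    climb stops, the ordinal is finite. *)
Lemma omega_or_finite b : ole omega b \/ exists n, oeq b (ofin n).
Proof.
have [[b0]|empty] := pselect (exists x : osort b, True); last first.
  right; exists 0; apply: (oeq_trans _ (oeq_sym ofin0)).
  have f (x : osort b) : void by exfalso; apply: empty; exists x.
  exists f; last by move=> x; case: (f x).
  by exists (fun v : void => match v with end) => x; [case: (f x)|case: x].
move=> _; have [|o _ omin] := @oleq_min b setT; first by exists b0.
have /choice[s sP] (x : osort b) : exists y, (exists y, ~ oleq y x) ->
    ~ oleq y x /\ forall z, ~ oleq z x -> oleq y z.
  have [[y yx]|none] := pselect (exists y, ~ oleq y x); last by exists x => /none.
  by have [|z zx zmin] := @oleq_min b [set y | ~ oleq y x]; [exists y|exists z].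
pose e k := iter k s o.
have down k z : (forall j, j < k -> exists y, ~ oleq y (e j)) -> oleq z (e k) ->
    exists2 j, j <= k & e j = z.
  elim: k z => [|k IH] z cl zk; first by exists 0 => //; apply: oleq_anti => //; apply: omin.
  have [zk'|nzk] := pselect (oleq z (e k)).
    have [|j jk <-] := IH z _ zk'; last by exists j => //; apply: leqW.
    by move=> j jk; apply: cl; apply: leqW.
  exists k.+1 => //; apply: oleq_anti => //.
  by have [_] := sP _ (cl k (ltnSn k)); apply.
have up j k : j < k -> (forall j, j < k -> exists y, ~ oleq y (e j)) -> ~ oleq (e k) (e j).
  elim: k => // k IH; rewrite ltnS leq_eqVlt => /orP[/eqP ->|jk] cl.
    by have [] := sP _ (cl k (ltnSn k)).
  have [nk _] := sP _ (cl k (ltnSn k)) => kj.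
  apply: IH => //; first by move=> i ik; apply: cl; apply: leqW.
  exact: oleq_trans (oleqN nk) kj.
have mono k i j : (forall j, j < k -> exists y, ~ oleq y (e j)) -> i <= k -> j <= k ->
    oleq (e i) (e j) = (i <= j).
  move=> cl ik jk; apply/idP/idP => [eij|].
    rewrite leqNgt; apply/negP => ji; apply: (up j i) eij => // l li.
    by apply: cl; apply: leq_trans li _.
  rewrite leq_eqVlt => /orP[/eqP ->|ij]; first exact: oleqxx.
  apply: oleqN; apply: up => // l lj.
  by apply: cl; apply: leq_trans lj _.
have [all|/existsNP[k kmax]] := pselect (forall k, exists y, ~ oleq y (e k)).
  left; exists e; split=> [i j|k z /down[//|j _ <-]]; last by exists j.
  by apply: (mono (maxn i j)) => //; [apply: leq_maxl|apply: leq_maxr].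
right; have [k0 k0max k0min] : exists2 k, (forall y, oleq y (e k)) &
    forall j, j < k -> exists y, ~ oleq y (e j).
  pose Q k := `[< forall y, oleq y (e k) >].
  have exQ : exists k, Q k.
    exists k; apply/asboolP => y; apply: contrapT => ny; apply: kmax; by exists y.
  exists (ex_minn exQ); case: ex_minnP => m /asboolP // _ mmin j.
  by rewrite ltnNge => /negP jm; apply: contrapT => /forallNP nj; apply: jm;
    apply: mmin; apply/asboolP => y; apply: contrapT.
exists k0.+1; apply: oeq_sym; exists (fun i : 'I_k0.+1 => e i).
  have surj z : exists i : 'I_k0.+1, e i = z.
    have [j jk <-] := down k0 z k0min (k0max z).
    by exists (Ordinal (jk : j < k0.+1)).
  have ik (i : 'I_k0.+1) : i <= k0 by rewrite -ltnS.
  have /choice[h hP] := surj; exists h => // i; apply/val_inj/eqP.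
  have ehi := hP (e i); rewrite eqn_leq.
  rewrite -(mono k0 (h (e i)) i) // -(mono k0 i (h (e i))) // ehi.
  by rewrite oleqxx.
by move=> i j; apply: (mono k0) => //; rewrite -ltnS.
Qed.

Lemma lt_omega b : olt b omega -> exists n, oeq b (ofin n).
Proof.
move=> [[f [fmono finit]] nb].
have finj : injective f.
  by move=> x y fxy; apply: oleq_anti; rewrite -fmono fxy; apply: oleqxx.
have [surj|/existsNP[k kmiss]] := pselect (forall k, exists x, f x = k).
  exfalso; apply: nb; exists f => //; have /choice[h hP] := surj.
  by exists h => // x; apply: finj; rewrite hP.
pose Q k := `[< ~ exists x, f x = k >].
have exQ : exists k, Q k by exists k; apply/asboolP.
pose n := ex_minn exQ; exists n; rewrite /n; case: ex_minnP => m /asboolP nm mmin.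
have fm x : f x < m.
  by rewrite ltnNge; apply/negP => /(finit x).
exists (fun x => Ordinal (fm x)); last by move=> x y; apply: fmono.
have /choice[h hP] (i : 'I_m) : exists x, f x = i.
  apply: contrapT => ni; have : m <= i by apply: mmin; apply/asboolP.
  by rewrite leqNgt ltn_ord.
by exists h => x; [apply: finj; rewrite hP|apply: val_inj; rewrite /= hP].
Qed.

Lemma ofin_lt_omega n : olt (ofin n) omega.
Proof. by split; [apply: ole_ofin_omega|apply: omega_neq_ofin]. Qed.

(** By [omega_or_finite], the only candidates for the least ordinal are
    [omega] and the [ofin n]. *)
Lemma least_ord (P : Ord -> Prop) : (forall a b, oeq a b -> P a -> P b) ->
  P omega -> exists a, [/\ P a, ole a omega & forall b, P b -> ole a b].
Proof.
move=> Peq Pomega; have [[n Pn]|none] := pselect (exists n, P (ofin n)); last first.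
  exists omega; split=> // [|b Pb]; first exact/oeq_ole/oeq_refl.
  have [//|[n bn]] := omega_or_finite b.
  by exfalso; apply: none; exists n; apply: Peq Pb.
have exQ : exists n, `[< P (ofin n) >] by exists n; apply/asboolP.
exists (ofin (ex_minn exQ)); case: ex_minnP => m /asboolP Pm mmin.
split=> // [|b Pb]; first exact: ole_ofin_omega.
have [ob|[k bk]] := omega_or_finite b.
  exact: ole_trans (ole_ofin_omega m) ob.
apply: ole_trans (oeq_ole (oeq_sym bk)); apply: ole_ofin; apply: mmin.
exact/asboolP/(Peq b).
Qed.

(** * Doubly transitive orders *)

Section Interval.
Import Order.TTheory.
Variables (d : Order.disp_t) (I : orderType d).
Hypothesis I_dt : doubly_transitive I.

Let lt (x y : I) : Prop := (x < y)%O.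

Let lt_order : strict_order lt.
Proof.
rewrite /lt; split=> [x|y x z|x y]; [by rewrite ltxx|exact: lt_trans|].
by case: (ltgtP x y); [constructor 1|constructor 3|constructor 2].
Qed.

Let itvE (a b x : I) : `[a, b]%classic x <-> ~ lt x a /\ ~ lt b x.
Proof.
rewrite /= in_itv /= /lt; split=> [/andP[ax xb]|[/negP xa /negP bx]].
  by split; apply/negP; rewrite -leNgt.
by rewrite !leNgt xa bx.
Qed.

Lemma interval_iso (a b c e : I) : lt a b -> lt c e -> exists h : I -> I,
  [/\ h a = c, h b = e,
   forall x y, ~ lt x a -> ~ lt b y -> lt x y -> lt (h x) (h y) &
   forall y, ~ lt y c -> ~ lt e y -> exists x, [/\ ~ lt x a, ~ lt b x & h x = y]].
Proof.
have [_ _ _ _ homog] := I_dt; move=> ab ce.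
have [h [hfun _ hsurj] hmono] := homog _ _ _ _ ab ce.
have mono x y : ~ lt x a -> ~ lt b y -> lt x y -> lt (h x) (h y).
  move=> xa yb xy; have Ix : `[a, b]%classic x by apply/itvE; split=> // ?; ord lt_order.
  have Iy : `[a, b]%classic y by apply/itvE; split=> // ?; ord lt_order.
  by rewrite /lt ltNge hmono // -ltNge.
have surj y : ~ lt y c -> ~ lt e y -> exists x, [/\ ~ lt x a, ~ lt b x & h x = y].
  by move=> yc ey; have [|x /itvE[xa bx] hx] := hsurj y; [exact/itvE|exists x].
have img x : ~ lt x a -> ~ lt b x -> ~ lt (h x) c /\ ~ lt e (h x).
  by move=> xa bx; apply/itvE/hfun/itvE.
have naa : ~ lt a a := lt_irr lt_order (x := a).
have nbb : ~ lt b b := lt_irr lt_order (x := b).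
have nba : ~ lt b a by ord lt_order.
exists h; split=> //.
  have [ca _] := img a naa nba; have [||x [xa bx hx]] := surj c; try by ord lt_order.
  case: (lt_tot lt_order a x) => [ax|-> //|//].
  by have := mono _ _ naa bx ax; rewrite hx.
have [_ be] := img b nba nbb; have [||x [xa bx hx]] := surj e; try by ord lt_order.
case: (lt_tot lt_order b x) => [//|-> //|xb].
by have := mono _ _ xa nbb xb; rewrite hx.
Qed.

Lemma doubly_transitive_bump (l a b r : I) : lt l a -> lt l b -> lt a r -> lt b r ->
  exists s, [/\ aut lt s, s a = b & forall x, ~ (lt l x /\ lt x r) -> s x = x].
Proof.
move=> la lb ar br.
have [h [hl ha hmono hsurj]] := interval_iso la lb.
have [k [ka kr kmono ksurj]] := interval_iso ar br.
pose s x := if pselect (lt l x) then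
  if pselect (lt a x) then if pselect (lt x r) then k x else x else h x else x.
have spec x : [\/ [/\ ~ lt l x, s x = x & True],
    [/\ lt l x, ~ lt a x & [/\ s x = h x, lt l (h x) & ~ lt b (h x)]],
    [/\ lt a x, lt x r & [/\ s x = k x, lt b (k x) & lt (k x) r]] |
    [/\ ~ lt x r, s x = x & True]].
  rewrite /s; case: pselect => /= [lx|]; last by constructor 1.
  case: pselect => /= [ax|nax].
    case: pselect => /= [xr|]; last by constructor 4.
    constructor 3; split=> //; split=> //.
      by rewrite -ka; apply: kmono => //; [apply: (lt_irr lt_order)|apply: (lt_le lt_order)].
    by rewrite -kr; apply: kmono => //; [apply: (lt_le lt_order)|apply: (lt_irr lt_order)].
  constructor 2; split=> //; split=> //.
    by rewrite -hl; apply: hmono => //; apply: (lt_irr lt_order).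
  rewrite -ha; case: (lt_tot lt_order x a) => [xa|->|//]; last exact: (lt_irr lt_order).
  by apply: (lt_le lt_order) => //; apply: hmono => //;
    [apply: (lt_le lt_order)|apply: (lt_irr lt_order)].
have smono x y : lt x y -> lt (s x) (s y).
  move=> xy; case: (spec x) => [[xl -> _]|[lx xa [-> hx1 hx2]]|[ax xr [-> kx1 kx2]]|[xr -> _]];
  case: (spec y) => [[yl -> _]|[ly ya [-> hy1 hy2]]|[ay yr [-> ky1 ky2]]|[yr -> _]];
  try (by ord lt_order).
    by apply: hmono => //; ord lt_order.
  by apply: kmono => //; ord lt_order.
exists s; split.
- split=> [x y|y].
    split=> [sxy|]; last exact: smono.
    case: (lt_tot lt_order x y) => [//|xy|/smono yx]; last by ord lt_order.
    by rewrite xy in sxy; have := lt_irr lt_order sxy.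
  have [ly|ly] := pselect (lt l y); last first.
    by exists y; rewrite /s; case: pselect.
  have [yr|yr] := pselect (lt y r); last first.
    have ay : lt a y by ord lt_order.
    by exists y; rewrite /s; case: pselect => //= _; case: pselect => //= _; case: pselect.
  have [yb|yb] := pselect (lt b y).
    have [||x [xa rx kx]] := ksurj y; try by ord lt_order.
    exists x; have ax : lt a x.
      case: (lt_tot lt_order a x) => // xE; rewrite -xE ka in kx.
      by rewrite kx in yb; have := lt_irr lt_order yb.
    have xr : lt x r.
      case: (lt_tot lt_order x r) => // xE; rewrite xE kr in kx.
      by rewrite kx in yr; have := lt_irr lt_order yr.
    rewrite /s; case: pselect => [lx|[]] /=; last by ord lt_order.
    by case: pselect => // ?; case: pselect.
  have [||x [xl ax hx]] := hsurj y; try by ord lt_order.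
  exists x; have lx : lt l x.
    case: (lt_tot lt_order l x) => // xE; rewrite -xE hl in hx.
    by rewrite hx in ly; have := lt_irr lt_order ly.
  by rewrite /s; case: pselect => //= ?; case: pselect.
- rewrite /s; case: pselect => // ?; case: pselect => //= /(lt_irr lt_order) //.
- move=> x nx; rewrite /s; case: pselect => //= lx; case: pselect => //= ax.
    by case: pselect => //= xr; case: nx.
  by case: nx; split=> //; ord lt_order.
Qed.

Lemma doubly_transitive_homogeneous : homogeneous lt.
Proof.
have [_ dense nol nor _] := I_dt; split.
- exact: lt_order.
- by move=> x y /dense[z /andP[]]; exists z.
- exact: nol.
- exact: nor.
- exact: doubly_transitive_bump.
Qed.
End Interval.

Section Elementary.
Variables (T : Type) (lt : T -> T -> Prop).
Hypothesis lt_hom : homogeneous lt.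

Lemma finite_lower n (F : 'I_n -> T) a : exists2 l, lt l a &
  forall j, lt (F j) a -> ~ lt l (F j).
Proof.
elim: n F => [|n IH] F.
  by have [l la] := lt_unbounded_l lt_hom a; exists l => // -[].
have [l la lF] := IH (fun j => F (lift ord0 j)).
have lift_or (j : 'I_n.+1) : j = ord0 \/ exists i, j = lift ord0 i.
  by case: (unliftP ord0 j) => [i|]; [right; exists i|left].
have [[F0 F0']|F0] := pselect (lt (F ord0) a /\ lt l (F ord0)).
  exists (F ord0) => // j; have [->|[i ->]] := lift_or j; first by move=> _; apply: lt_irr.
  by move=> /lF lFi; ord lt_hom.
exists l => // j; have [->|[i ->]] := lift_or j; last exact: lF.
by move=> Fa lF0; apply: F0.
Qed.
End Elementary.

Section Homogeneity.
Variables (T : Type) (lt : T -> T -> Prop).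
Hypothesis lt_hom : homogeneous lt.

(** One point at a time: the automorphism found for the other points is
    corrected by a bump in an interval that contains none of them. *)
Lemma finite_homogeneity n (v w : 'I_n -> T) :
  (forall i j, lt (v i) (v j) <-> lt (w i) (w j)) ->
  exists2 s, aut lt s & forall i, s (v i) = w i.
Proof.
elim: n v w => [|n IH] v w vw; first by exists id; [apply: aut_id|case].
have [s saut sv] := IH (fun j => v (lift ord0 j)) (fun j => w (lift ord0 j))
  (fun i j => vw _ _).
set a := s (v ord0); set b := w ord0; pose F j := w (lift ord0 j).
have Fa j : lt (F j) a <-> lt (F j) b by rewrite /F -sv /a saut.1 vw sv.
have aF j : lt a (F j) <-> lt b (F j) by rewrite /F -sv /a saut.1 vw sv.
have [m [ma mb mFa mFb]] : exists m, [/\ lt m a, lt m b,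
    forall j, lt (F j) a -> ~ lt m (F j) & forall j, lt (F j) b -> ~ lt m (F j)].
  have [l la lF] := finite_lower lt_hom F a; have [l' l'b l'F] := finite_lower lt_hom F b.
  have [ll|ll] := pselect (lt l l'); [exists l|exists l'];
    split=> //; try (by ord lt_hom); move=> j Fj;
    by [apply: lF; apply/Fa|apply: l'F; apply/Fa].
have [q [aq bq qFa qFb]] : exists q, [/\ lt a q, lt b q,
    forall j, lt a (F j) -> ~ lt (F j) q & forall j, lt b (F j) -> ~ lt (F j) q].
  have [l la lF] := finite_lower (homogeneous_dual lt_hom) F a.
  have [l' l'b l'F] := finite_lower (homogeneous_dual lt_hom) F b.
  rewrite /dual_lt in la l'b lF l'F.
  have [ll|ll] := pselect (lt l' l); [exists l|exists l'];
    split=> //; try (by ord lt_hom); move=> j Fj;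
    by [apply: lF; apply/aF|apply: l'F; apply/aF].
have [t [taut tab tid]] := lt_bump lt_hom ma mb aq bq.
exists (t \o s); first exact: aut_comp.
move=> i /=; case: (unliftP ord0 i) => [j|] -> //; rewrite sv -/(F j).
case: (lt_tot lt_hom (F j) a) => [Fja|Fja|aFj].
- by apply: tid => -[mFj _]; apply: mFa mFj.
- rewrite Fja tab; case: (lt_tot lt_hom b (F j)) => [/aF|->//|/Fa];
    by rewrite Fja => /(lt_irr lt_hom).
- by apply: tid => -[_ Fq]; apply: qFa Fq.
Qed.
End Homogeneity.

(** * Karp complexity *)

Lemma vcons_comp (T U : Type) n (s : T -> U) x (v : 'I_n -> T) :
  vcons (s x) (fun i => s (v i)) = fun i => s (vcons x v i).
Proof. by apply/funext => i; rewrite /vcons; case: unlift. Qed.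

Definition graph (T U : Type) (f : T -> option U) : set (T * U) :=
  [set u | f u.1 = Some u.2].

Lemma graph_surj T U (G : set (T * U)) :
  (forall x y y', G (x, y) -> G (x, y') -> y = y') ->
  exists f : T -> option U, graph f = G.
Proof.
move=> Gf; have /choice[f fP] x : exists o : option U, forall y, o = Some y <-> G (x, y).
  have [[y Gy]|none] := pselect (exists y, G (x, y)).
    by exists (Some y) => z; split=> [[<-]//|/(Gf _ _ _ Gy) ->].
  by exists None => y; split=> // Gy; case: none; exists y.
by exists f; apply/seteqP; split=> -[x y] /= /fP.
Qed.

Section Ranks.
Import Order.TTheory.
Variables mu lam : Type.
Hypothesis mu_uncountable : ~ countable [set: mu].
Hypothesis lam_succ : is_card_succ mu lam.
Variables (d : Order.disp_t) (I : orderType d).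
Hypothesis I_dt : doubly_transitive I.
Local Notation M := (order_structure I).
Local Notation small A := (card_lt A [set: lam]).

Let lt (x y : I) : Prop := (x < y)%O.
Let lt_hom : homogeneous lt := doubly_transitive_homogeneous I_dt.

Lemma eval_aut (s : I -> I) n (v : 'I_n -> M) (t : term order_language n) :
  eval (M := M) (fun i => s (v i)) t = s (eval v t).
Proof. by case: t => // -[]. Qed.

Lemma sat_aut (s : I -> I) n (phi : formula order_language n) (v : 'I_n -> M) :
  aut lt s -> sat (M := M) phi (fun i => s (v i)) <-> sat phi v.
Proof.
move=> saut; elim: phi v => {n} [n|n t t'|n R ts|n phi IH psi IH'|n phi IH] v //=.
- rewrite !eval_aut; split=> [|->//]; exact: (aut_inj lt_hom).
- rewrite !eval_aut !leNgt; split=> /negP nlt; apply/negP; apply: contra_not nlt;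
    by move/saut.1.
- by split=> h /IH/h/IH'.
- split=> h x; first by apply/IH; rewrite -vcons_comp; apply: h.
  by have [y <-] := saut.2 x; rewrite vcons_comp; apply/IH; apply: h.
Qed.

(** A finite piece of an order-preserving map extends to an automorphism, which
    preserves the truth of all formulas. *)
Lemma elementary_ordpres (f : M -> option M) :
  elementary_pmap f <-> ordpres lt (graph f).
Proof.
split=> [fel [x x'] [y y'] fx fy|fo n phi v w fvw].
  pose phi := @FRel order_language 2 tt (fun i => TVar order_language i).
  have := fel 2 phi (fun i => if i == ord0 then y else x)
    (fun i => if i == ord0 then y' else x').
  move=> /(_ _)/= []; first by move=> i; case: ifP.
  by rewrite /lt /= !ltNge => h h'; split; apply: contra.
have [s saut sv] : exists2 s, aut lt s & forall i, s (v i) = w i.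
  apply: (finite_homogeneity lt_hom) => i j.
  by apply: (fo (v i, w i) (v j, w j)); apply: fvw.
have -> : w = fun i => s (v i) by apply/funext => i; rewrite sv.
by have [sv1 sv2] := sat_aut phi v saut; split.
Qed.

Lemma partial_isoE (f : M -> option M) :
  partial_iso lam f <-> ordpres lt (graph f) /\ small (graph f).
Proof.
rewrite /partial_iso elementary_ordpres; split=> -[]; last first.
  move=> fo sf; split=> //; apply: (small_sub lam_succ) (small_image lam_succ fst sf) _.
  by move=> x [y fx]; exists (x, y).
move=> sd fo; split=> //.
apply: (small_sub lam_succ) (small_image lam_succ (fun x => (x, odflt x (f x))) sd) _.
by move=> [x y] /= fx; exists x; [exists y|rewrite fx].
Qed.

Local Notation map_game n f := (game lam lt n setT setT (graph f)).

Lemma game_partial_iso n f : map_game n f -> partial_iso lam (f : M -> option M).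
Proof. by move=> /game_base[fo fs _]; apply/partial_isoE. Qed.

Lemma pextends_graph (f h : M -> option M) : pextends h f <-> graph f `<=` graph h.
Proof. by split=> [fh [x y] /fh|fh x y fx]; [|exact: (fh (x, y))]. Qed.

Lemma pdom_graph (f : M -> option M) : pdom f = fst @` graph f.
Proof.
apply/seteqP; split=> [x [y fx]|_ [[x y] fx <-]]; first by exists (x, y).
by exists y.
Qed.

Lemma prange_graph (f : M -> option M) : prange f = snd @` graph f.
Proof.
apply/seteqP; split=> [y [x fx]|_ [[x y] fx <-]]; first by exists (x, y).
by exists x.
Qed.

Lemma game_graph n G : game lam lt n setT setT G ->
  exists f : M -> option M, graph f = G.
Proof.
move=> /game_base[Go _ _]; apply: graph_surj => x y y'; exact: (ordpres_func lt_hom).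
Qed.

(** The cases of [Rank_ge] are told apart by the ordinal only up to
    isomorphism, whence the hypothesis on [a]. *)
Lemma Rank_ge_game a n f : Rank_ge lam a (f : M -> option M) -> oeq a (ofin n) ->
  partial_iso lam f -> map_game n f.
Proof.
elim: n a f => [|n IH] a f fa an /[dup] fp /partial_isoE[fo fs]; first by split.
split=> //; case: fa an => {a f fp fo fs} [a f a0|a f [_ nsucc] _|a b f ab forth back] an.
- case: (@osucc_neq0 (ofin n)); apply: oeq_trans a0; apply: oeq_sym.
  exact: oeq_trans an (ofinS n).
- by case: nsucc; exists (ofin n); apply: oeq_trans an (ofinS n).
have bn : oeq b (ofin n).
  apply: oeq_osuccI; apply: oeq_trans (oeq_sym ab) _.
  exact: oeq_trans an (ofinS n).
split=> C sC _.
  have [h [hp fh Ch rh]] := forth C sC; exists (graph h); split.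
  - exact/pextends_graph.
  - by rewrite -pdom_graph.
  - exact: IH rh bn hp.
have [h [hp fh Ch rh]] := back C sC; exists (graph h); split.
- exact/pextends_graph.
- by rewrite -prange_graph.
- exact: IH rh bn hp.
Qed.

Lemma game_Rank_ge a n f : map_game n f -> oeq a (ofin n) -> Rank_ge lam a (f : M -> option M).
Proof.
elim: n a f => [|n IH] a f.
  by move=> _ a0; apply: Rank_ge_zero; apply: oeq_trans a0 ofin0.
move=> [_ [forth back]] an; apply: (@Rank_ge_succ _ _ _ _ a (ofin n)).
- exact: oeq_trans an (ofinS n).
- move=> C sC; have [//|G [fG CG rG]] := forth C sC.
  have [h hG] := game_graph rG; subst G; exists h; split.
  + exact: game_partial_iso rG.
  + exact/pextends_graph.
  + by rewrite pdom_graph.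
  + exact: IH rG (oeq_refl _).
- move=> C sC; have [//|G [fG CG rG]] := back C sC.
  have [h hG] := game_graph rG; subst G; exists h; split.
  + exact: game_partial_iso rG.
  + exact/pextends_graph.
  + by rewrite prange_graph.
  + exact: IH rG (oeq_refl _).
Qed.

Lemma Rank_ge_omega f : Rank_ge lam omega (f : M -> option M) ->
  partial_iso lam f -> forall n, map_game n f.
Proof.
move=> fomega fp n; suff : Rank_ge lam (ofin n) (f : M -> option M).
  by move/Rank_ge_game; apply=> //; apply: oeq_refl.
have [nz nsucc] := olimit_omega.
move: fomega; move: omega nz nsucc (@ofin_lt_omega n) => o nz nsucc on fo.
case: fo nz nsucc on => {f fp o} [o f o0 /(_ o0)//|o f _ h _ _ /h//|o b f ob _ _ _ nsucc].
by case: nsucc; exists b.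
Qed.

Lemma game_omega f : (forall n, map_game n f) -> Rank_ge lam omega (f : M -> option M).
Proof.
move=> rf; apply: Rank_ge_limit; first exact: olimit_omega.
by move=> b /lt_omega[n bn]; apply: game_Rank_ge (rf n) bn.
Qed.

Lemma Rank_stable_omega : Rank_stable lam M omega.
Proof.
move=> f fp /Rank_ge_omega/(_ fp) rf.
apply: (@Rank_ge_succ _ _ _ _ _ omega); first exact: oeq_refl.
- move=> C sC; have [G [fG CG rG]] :=
    omega_forth mu_uncountable lam_succ lt_hom rf sC.
  have [h hG] := game_graph (rG 0); subst G; exists h; split.
  + exact: game_partial_iso (rG 0).
  + exact/pextends_graph.
  + by rewrite pdom_graph.
  + exact: game_omega.
- move=> C sC; have [G [fG CG rG]] :=
    omega_back mu_uncountable lam_succ lt_hom rf sC.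
  have [h hG] := game_graph (rG 0); subst G; exists h; split.
  + exact: game_partial_iso (rG 0).
  + exact/pextends_graph.
  + by rewrite prange_graph.
  + exact: game_omega.
Qed.

End Ranks.

Lemma olt_eq a b c : olt c a -> oeq a b -> olt c b.
Proof.
move=> [ca nca] ab; split; first exact: ole_trans (oeq_ole ab).
by move=> cb; apply: nca; apply: oeq_trans (oeq_sym ab).
Qed.

Lemma olimit_eq a b : olimit a -> oeq a b -> olimit b.
Proof.
move=> [nz ns] ab; split=> [b0|[c bc]]; first by apply: nz; apply: oeq_trans b0.
by apply: ns; exists c; apply: oeq_trans bc.
Qed.

Lemma Rank_ge_eq lam L (M N : structure L) a b (f : M -> option N) :
  oeq a b -> Rank_ge lam a f -> Rank_ge lam b f.
Proof.
move=> ab fa; case: fa b ab => {a f} [a f a0|a f lima h|a c f ac forth back] b ab.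
- by apply: Rank_ge_zero; apply: oeq_trans (oeq_sym ab) a0.
- apply: Rank_ge_limit; first exact: olimit_eq lima ab.
  by move=> c cb; apply: h; apply: olt_eq cb (oeq_sym ab).
- by apply: (Rank_ge_succ _ forth back); apply: oeq_trans (oeq_sym ab) ac.
Qed.

Lemma Rank_stable_eq lam L (M : structure L) a b :
  oeq a b -> Rank_stable lam M a -> Rank_stable lam M b.
Proof.
move=> ab sta f fp /(Rank_ge_eq (oeq_sym ab))/(sta f fp).
exact/Rank_ge_eq/oeq_osucc.
Qed.

Theorem theorem3p14 (mu lam : Type)
    (mu_uncountable : ~ countable [set: mu]%classic)
    (lam_succ : is_card_succ mu lam) :
  exists2 s : Ord, is_KC_class lam K2tr s & ole s omega.
Proof.
have KC M : K2tr M -> exists2 a, is_KC lam M a & ole a omega.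
  move=> [d [I [I_dt ->]]].
  have [|a [sta ale amin]] := @least_ord (Rank_stable lam (order_structure I))
    (@Rank_stable_eq _ _ _) _; last by exists a.
  exact: Rank_stable_omega mu_uncountable lam_succ _ _ I_dt.
have [||s [bound sle smin]] := @least_ord (fun t => forall M a, K2tr M ->
    is_KC lam M a -> ole a t).
- move=> t t' tt' bound M a KM aKC.
  exact: ole_trans (bound M a KM aKC) (oeq_ole tt').
- move=> M a /KC[b [stb _] bo] [_ amin]; exact: ole_trans (amin b stb) bo.
exists s => //; split=> // M KM.
by have [a aKC _] := KC M KM; exists a => //; apply: bound aKC.
Qed.
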